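(* Let $K$ be a field of characteristic $0$ and let $n \ge 5$. Let $\mathcal{A} \subseteq (\mathbb{Z}_{\ge 0})^n$ be a homogeneous support set which is symmetric, i.e., every permutation of (the coordinates of) an element of $\mathcal{A}$ also lies in $\mathcal{A}$. Let $k$ be the minimal number of strictly positive entries among all elements of $\mathcal{A}$. Then for general coefficients of $f \in K^{\mathcal{A}}$ with respect to $\mathcal{A}$, $$\sqrt{(S_n.f)} = (S_n.\,x_1x_2\cdots x_k).$$ In particular, the common zero set of $S_n.f$ consists of all points of $\overline{K}^n$ with at least $n-k+1$ zero entries.
   Context: A support set is a non-empty finite subset $\mathcal{A}\subseteq(\mathbb{Z}_{\ge0})^n$; monomials are identified with exponent vectors; $\mathcal{A}$ is homogeneous if all its elements have the same coordinate sum. $K^{\mathcal{A}}$ is identified with the polynomials whose support is contained in $\mathcal{A}$. $S_n$ acts by $\sigma.x_i = x_{\sigma(i)}$; $S_n.f$ is the orbit and $(S_n.f)$ the ideal it generates; $(S_n.\,x_1\cdots x_k)$ is the ideal generated by all square-free monomials of degree $k$. ''For general coefficients of $f$ with respect to $\mathcal{A}$'' means: the set of $f\in K^{\mathcal{A}}$ for which the assertion holds contains a non-empty Zariski-open subset of $K^{\mathcal{A}}$. *)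

(* Defs.v *)
From HB Require Import structures.
From mathcomp Require Import all_boot all_order all_algebra all_fingroup.
From mathcomp Require Import mpoly.
Set Implicit Arguments. Unset Strict Implicit. Unset Printing Implicit Defensive.
Import Order.TTheory GRing.Theory.
Local Open Scope ring_scope.

Definition in_ideal (K : comNzRingType) (n : nat)
  (G : {mpoly K[n]} -> Prop) (p : {mpoly K[n]}) : Prop :=
  exists (r : nat) (g c : 'I_r -> {mpoly K[n]}),
    (forall i, G (g i)) /\ p = \sum_(i < r) c i * g i.

Definition in_radical (K : comNzRingType) (n : nat)
  (G : {mpoly K[n]} -> Prop) (p : {mpoly K[n]}) : Prop :=
  exists e : nat, in_ideal G (p ^+ e).

(* The orbit S_n.f, where sigma acts by x_i |-> x_(sigma i) (msym). *)
Definition orbit_set (K : comNzRingType) (n : nat) (f : {mpoly K[n]})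
  : {mpoly K[n]} -> Prop :=
  fun q => exists s : 'S_n, q = msym s f.

(* Square-free monomials of degree k (generators of (S_n. x_1 ... x_k)). *)
Definition sqfree_monomials (K : comNzRingType) (n k : nat)
  : {mpoly K[n]} -> Prop :=
  fun q => exists m : 'X_{1..n},
    (forall i, (m i <= 1)%N) /\ mdeg m = k /\ q = 'X_[m].

Definition mperm (n : nat) (m : 'X_{1..n}) (s : 'S_n) : 'X_{1..n} :=
  [multinom m (s i) | i < n].

Definition npos (n : nat) (m : 'X_{1..n}) : nat := #|[pred i | (0 < m i)%N]|.

(* The polynomial in K^A with coefficient vector c, where A is listed
   (without repetition) as the sequence A. *)
Definition poly_of_coeffs (K : comNzRingType) (n : nat) (A : seq 'X_{1..n})
  (c : 'I_(size A) -> K) : {mpoly K[n]} :=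
  \sum_(i < size A) c i *: 'X_[nth 0%MM A i].

Definition zero_locus (K : comNzRingType) (m : nat) (S : {mpoly K[m]} -> Prop)
  (v : 'I_m -> K) : Prop :=
  forall g, S g -> g.@[v] = 0.

(* "For general coefficients of f w.r.t. A, P f holds": the set of
   coefficient vectors c in K^A with P (f_c) contains a non-empty
   Zariski-open subset, i.e. the complement of some vanishing locus V(S)
   that is a proper subset of K^A. *)
Definition general_coeffs (K : comNzRingType) (n : nat) (A : seq 'X_{1..n})
  (P : {mpoly K[n]} -> Prop) : Prop :=
  exists S : {mpoly K[size A]} -> Prop,
    (exists c, ~ zero_locus S c) /\
    (forall c, ~ zero_locus S c -> P (@poly_of_coeffs K n A c)).

(* Main.v *)
Require Import Defs.
From HB Require Import structures.
From mathcomp Require Import all_boot all_order all_algebra all_fingroup.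
From mathcomp Require Import ring zify ring_quotient fraction generic_quotient.
From mathcomp Require boolp classical_sets.
From mathcomp Require Import mpoly.
Set Implicit Arguments. Unset Strict Implicit. Unset Printing Implicit Defensive.
Import Order.TTheory GRing.Theory.
Local Open Scope ring_scope.

(** Let [x] be a point over an extension field with at least [k] nonzero
    coordinates. That the orbit of [f_c] vanishes at [x] is a linear system in the
    coefficients [c], whose equations span an [S_n]-stable space [V_x]. For
    [n >= 5] a representation of [S_n] on which [A_n] acts nontrivially has
    dimension at least [n - 1], so [V_x] has rank at least [n - 1], unless all
    ratios of coordinates of [x] are roots of unity of bounded order; and some
    [n * n] minor of the system does not vanish identically in [x]. As [x] varies
    in an [(n - 1)]-dimensional projective space, a dimension count shows that the
    [c] admitting such an [x] satisfy a nonzero polynomial equation: either the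
    rank is at least [n], or it is [n - 1] and [x] lies on a hypersurface. The
    exceptional [x] are excluded by a norm from a group algebra. Since [x] ranges
    over all extension fields, the statement on radicals follows from the existence
    of prime ideals avoiding the powers of a given element. *)

(** * Small representations of the symmetric group *)

(** Rank [n - 1] is the borderline case: it imposes as many conditions on [c] as [x] has parameters.
    It does occur: if [A] consists of the pure powers of degree [d > 0], the orbit system has rank
    [n - 1] at each nonzero [x] whose [d]-th powers of coordinates sum to zero. Hence the extra
    hypersurface, given by an [n * n] minor whose nonvanishing is seen on one curve of points with
    monomial coordinates. The bound [n >= 5] enters through the representations: [S_4] has one of
    dimension 2, factoring through [S_3], on which [A_4] acts nontrivially. The roots of unity come
    from the complementary case: if [A_n] fixes all equations, then [(i j)] acts on them like a
    disjoint [(k l)]. For a point without zero coordinates, comparing monomials with exponents [u]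
    and [v] at [i] and [j] then gives [(x_i / x_j) ^ (2 * (u - v)) = 1]. *)

Lemma mxrank_le1P (F : fieldType) (m n : nat) (U : 'M[F]_(m, n)) :
  (\rank U <= 1)%N -> exists2 w : 'rV[F]_n, (w <= U)%MS & exists D, U = D *m w.
Proof.
move=> rU; have [->|U0] := eqVneq U 0.
  by exists 0; [exact: sub0mx | exists 0; rewrite mulmx0].
have /rowV0Pn[w wU w0] : U != 0 by [].
exists w => //; apply/submxP.
by rewrite -(geq_leqif (mxrank_leqif_sup wU)) rank_rV w0.
Qed.

Lemma mulmx_invol_comm (F : fieldType) (n : nat) (A B : 'M[F]_n) :
  A *m A = 1%:M -> B *m B = 1%:M -> A *m B *m A *m B = 1%:M -> B *m A = A *m B.
Proof.
move=> AA BB CC; transitivity (A *m (A *m B *m A *m B) *m B).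
  by rewrite !mulmxA AA mul1mx -[_ *m B *m B]mulmxA BB mulmx1.
by rewrite CC mulmx1.
Qed.

Lemma two_outside (T : finType) (X : {set T}) (s : seq T) :
  ((size s).+1 < #|X|)%N ->
  exists a b, [/\ a \in X, b \in X & a != b] /\ (a \notin s) && (b \notin s).
Proof.
move=> sX; have /card_gt1P[a [b [aY bY ab]]] : (1 < #|X :\: [set x in s]|)%N.
  have : (#|X :&: [set x in s]| <= size s)%N.
    by rewrite (leq_trans (subset_leq_card (subsetIr _ _))) // cardsE card_size.
  by rewrite cardsD; move: sX; move: #|X| #|X :&: _| (size s); lia.
exists a, b; move: aY bY; rewrite !inE => /andP[-> ->] /andP[-> ->].
by rewrite ab.
Qed.

Section TranspositionOperators.
Variables (F : fieldType) (T : finType) (N : nat).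
Implicit Types (t : T -> T -> 'M[F]_N) (X Y : {set T}).

(* [t i j] stands for the action of the transposition [(i j)]; only relations
   stable under [t -> - t] are used, so that twisting by the sign is free. *)
Definition transp_rel t := [/\ forall i j, t i j = t j i,
  forall i j, i != j -> t i j *m t i j = 1%:M &
  forall i j k l, i != j -> k != l ->
    t i j *m t k l *m t i j = t (tperm i j k) (tperm i j l)].

Definition stableT t X m (U : 'M[F]_(m, N)) :=
  forall i j, i \in X -> j \in X -> i != j -> (U *m t i j <= U)%MS.

(** Since 3-cycles generate the alternating group of [X], this is the trivial action of that group
    on the row space of [U]. *)
Definition triv3 t X m (U : 'M[F]_(m, N)) :=
  forall i j k, i \in X -> j \in X -> k \in X -> i != j -> j != k -> i != k ->
  U *m t i j *m t j k = U.

Definition triv22 t X m (U : 'M[F]_(m, N)) :=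
  forall i j k l, i \in X -> j \in X -> k \in X -> l \in X ->
  i != j -> k != l -> i != k -> i != l -> j != k -> j != l ->
  U *m t i j *m t k l = U.

Lemma transp_relN t : transp_rel t -> transp_rel (fun i j => - t i j).
Proof.
case=> ts ti tc; split=> [i j|i j ij|i j k l ij kl]; first by rewrite ts.
  by rewrite mulNmx mulmxN opprK ti.
by rewrite !(mulNmx, mulmxN, opprK) tc.
Qed.

(** Every pair is reached from [(a, b)] by swapping the entries and replacing one at a time. This
    spreads a property of one transposition to all its conjugates. *)
Lemma pair_transport X (P : T -> T -> Prop) a b :
  (forall i j, i \in X -> j \in X -> i != j -> P i j -> P j i) ->
  (forall i j k, i \in X -> j \in X -> k \in X -> i != j -> i != k -> j != k ->
    P i j -> P i k) ->
  a \in X -> b \in X -> a != b -> P a b ->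
  forall i j, i \in X -> j \in X -> i != j -> P i j.
Proof.
move=> Ps Pt aX bX ab Pab.
have Pa j : j \in X -> a != j -> P a j.
  by move=> jX aj; have [<-//|bj] := eqVneq b j; apply: (Pt a b).
move=> i j iX jX ij; have [ai|ai] := eqVneq a i.
  by rewrite -ai in ij *; apply: Pa.
have [<-|aj] := eqVneq a j; first by apply: Ps => //; apply: Pa.
apply: (Ps) => //; rewrite 1?eq_sym //; apply: (Pt j a) => //; rewrite 1?eq_sym //.
by apply: Ps => //; apply: Pa.
Qed.

Section Relations.
Variable t : T -> T -> 'M[F]_N.
Hypothesis tR : transp_rel t.

Lemma trS i j : t i j = t j i. Proof. by case: tR. Qed.
Lemma trI i j : i != j -> t i j *m t i j = 1%:M. Proof. by case: tR => _ + _; apply. Qed.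

Lemma trK m (U : 'M[F]_(m, N)) i j : i != j -> U *m t i j *m t i j = U.
Proof. by move=> ij; rewrite -mulmxA trI // mulmx1. Qed.

Lemma trC i j k l : i != j -> k != l -> i != k -> i != l -> j != k -> j != l ->
  t i j *m t k l = t k l *m t i j.
Proof.
move=> ij kl ik il jk jl; have [_ _ /(_ i j k l ij kl)] := tR.
by rewrite !tpermD // => {2}<-; rewrite trK.
Qed.

Lemma trB i j k : i != j -> j != k -> i != k -> t i j *m t j k = t i k *m t i j.
Proof.
move=> ij jk ik; have [_ _ /(_ i j j k ij jk)] := tR.
by rewrite tpermR tpermD // => <-; rewrite trK.
Qed.

Lemma trB2 i j k : i != j -> j != k -> i != k -> t i j *m t j k = t j k *m t i k.
Proof.
move=> ij jk ik; have [_ _ /(_ j k i j jk ij)] := tR.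
by rewrite tpermL tpermD 1?eq_sym // => <-; rewrite !mulmxA trI // mul1mx.
Qed.

Lemma trB1 i j k : i != j -> j != k -> i != k ->
  t j k *m (1%:M - t i j) = (1%:M - t i k) *m t j k.
Proof.
move=> ij jk ik; rewrite mulmxBl mulmxBr mul1mx mulmx1; congr (_ - _).
by rewrite (trS j k) (trS i j) trB ?(trS k i) // eq_sym.
Qed.

Lemma eigen_sqr i j (w : 'rV_N) a : i != j -> w != 0 -> w *m t i j = a *: w ->
  a ^+ 2 = 1.
Proof.
move=> ij w0 wa; apply/eqP; rewrite -subr_eq0; have := trK w ij.
rewrite wa -scalemxAl wa scalerA -expr2 => /eqP.
by rewrite -subr_eq0 -{2}[w]scale1r -scalerBl scalemx_eq0 (negPf w0) orbF.
Qed.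

(** On a common eigenvector the braid relation reads [a * b * a = b * a * b], and both eigenvalues
    square to 1. *)
Lemma eigen_braid i j k (w : 'rV_N) a b : i != j -> j != k -> i != k -> w != 0 ->
  w *m t i j = a *: w -> w *m t j k = b *: w -> a = b.
Proof.
move=> ij jk ik w0 wa wb.
have a2 := eigen_sqr ij w0 wa; have b2 := eigen_sqr jk w0 wb.
have E : w *m (t i j *m t j k *m t i j) = w *m (t j k *m t i j *m t j k).
  rewrite (trB ij jk ik) trK // -[X in _ = w *m X]mulmxA.
  by rewrite (trB2 ij jk ik) [X in _ = w *m X]mulmxA trI // mul1mx.
move: E; rewrite !mulmxA !(wa, wb, =^~ scalemxAl, scalerA).
rewrite mulrAC -expr2 a2 mulrAC -expr2 b2 !mul1r => /eqP.
by rewrite -subr_eq0 -scalerBl scalemx_eq0 (negPf w0) orbF subr_eq0 => /eqP->.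
Qed.

(** On a line each transposition acts by a sign, and two transpositions sharing a point have the
    same sign. *)
Lemma rank1_triv3 X m (U : 'M[F]_(m, N)) :
  stableT t X U -> (\rank U <= 1)%N -> triv3 t X U.
Proof.
move=> sU /mxrank_le1P[w wU [D UE]] i j k iX jX kX ij jk ik.
have [w0|w0] := eqVneq w 0; first by rewrite UE w0 mulmx0 !mul0mx.
have ev a b : a \in X -> b \in X -> a != b -> exists c, w *m t a b = c *: w.
  move=> aX bX ab; apply/sub_rVP/(submx_trans (submxMr _ wU)).
  by rewrite (submx_trans (sU _ _ aX bX ab)) // UE submxMl.
have [a wa] := ev _ _ iX jX ij; have [b wb] := ev _ _ jX kX jk.
rewrite UE -!mulmxA (mulmxA w) wa -scalemxAl wb scalerA.
by rewrite (eigen_braid ij jk ik w0 wa wb) -expr2 (eigen_sqr jk w0 wb) scale1r.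
Qed.

(** The product [(i j)(k l)] is that of the 3-cycles [(i j)(j k)] and [(j k)(k l)]. *)
Lemma triv3_triv22 X m (U : 'M[F]_(m, N)) : triv3 t X U -> triv22 t X U.
Proof.
move=> U3 i j k l iX jX kX lX ij kl ik il jk jl.
by rewrite -[U *m t i j](@trK _ _ j k) // U3 // U3.
Qed.

Hypothesis F0 : [pchar F] =i pred0.

Lemma natF0 n : (n.+1%:R : F) != 0.
Proof. by have /pcharf0P-> := F0. Qed.

(** * Representations in which a transposition acts as a reflection *)

Section Reflections.
Variables (X : {set T}) (m : nat) (U : 'M[F]_(m, N)) (a b : T).
Hypotheses (X5 : (4 < #|X|)%N) (sU : stableT t X U) (nU : ~ triv3 t X U).
Hypotheses (aX : a \in X) (bX : b \in X) (ab : a != b).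
Hypothesis rab : (\rank (U *m (1%:M - t a b)) <= 1)%N.

Lemma refl_rank i j : i \in X -> j \in X -> i != j ->
  (\rank (U *m (1%:M - t i j)) <= 1)%N.
Proof.
move: i j; apply: (@pair_transport X
  (fun i j => (\rank (U *m (1%:M - t i j)) <= 1)%N) a b) => // i j.
  by move=> _ _ _; rewrite trS.
move=> k iX jX kX ij ik jk; apply: leq_trans.
have -> : U *m (1%:M - t i k) = U *m t j k *m (1%:M - t i j) *m t j k.
  rewrite !mulmxBr !mulmx1 mulmxBl trK //; congr (_ - _).
  by rewrite -!mulmxA [t i j *m _]trB2 // [t j k *m (t j k *m _)]mulmxA trI // mul1mx.
by apply: leq_trans (mxrankM_maxl _ _) _; apply/mxrankS/submxMr/sU.
Qed.

Lemma refl_neq0 i j : i \in X -> j \in X -> i != j -> U *m (1%:M - t i j) != 0.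
Proof.
move=> iX jX ij; apply/eqP => U0; apply: nU.
have fx k l : k \in X -> l \in X -> k != l -> U *m t k l = U.
  move: k l; apply: (@pair_transport X (fun k l => U *m t k l = U) i j) => //.
  - by move=> k l _ _ _; rewrite trS.
  - move=> c d e cX dX eX cd ce de Ucd.
    have /submxP[D DE] := sU dX eX de.
    have -> : t c e = t d e *m t c d *m t d e.
      by rewrite -mulmxA trB2 // mulmxA trI // mul1mx.
    by rewrite !mulmxA DE -(mulmxA D) Ucd -DE trK.
  by apply/eqP; rewrite eq_sym -subr_eq0 -{1}[U]mulmx1 -mulmxBr U0.
by move=> k l c kX lX cX kl lc kc; rewrite !fx.
Qed.


(* If two disjoint transpositions share their reflection vector, then all of them
   do, and each 3-cycle is unipotent of order 3, hence trivial. *)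
Lemma refl_same_line p q k l (w : 'rV_N) :
  p \in X -> q \in X -> k \in X -> l \in X ->
  p != q -> k != l -> p != k -> p != l -> q != k -> q != l ->
  w != 0 -> (w <= U *m (1%:M - t p q))%MS -> w *m t k l = - w -> False.
Proof.
move=> pX qX kX lX pq kl pk pl qk ql w0 wpq wkl.
have wU : (w <= U)%MS.
  rewrite (submx_trans wpq) // mulmxBr mulmx1 addmx_sub // eqmx_opp.
  exact: sU.
have two0 : (2%:R : F) != 0 := natF0 1.
have inline i j : w *m t i j = - w -> (w <= U *m (1%:M - t i j))%MS.
  move=> wij; have -> : w = 2%:R^-1 *: (w *m (1%:M - t i j)).
    rewrite mulmxBr mulmx1 wij opprK -mulr2n -scaler_nat scalerA.
    by rewrite mulVf // scale1r.
  exact/scalemx_sub/submxMr.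
have neg i j : i != j -> (w <= U *m (1%:M - t i j))%MS -> w *m t i j = - w.
  move=> ij /submxP[D ->]; rewrite -!mulmxA mulmxBl mul1mx trI //.
  by rewrite -opprB !mulmxN.
have good i j c d : i \in X -> j \in X -> c \in X -> d \in X ->
    i != j -> c != d -> i != c -> i != d -> j != c -> j != d ->
    (w <= U *m (1%:M - t i j))%MS -> exists e, w *m t c d = e *: w.
  move=> iX jX cX dX ij cd ic id jc jd wij; apply/sub_rVP.
  have Uw : (U *m (1%:M - t i j) <= w)%MS.
    by rewrite -(geq_leqif (mxrank_leqif_sup wij)) rank_rV w0 refl_rank.
  apply: submx_trans (submxMr _ wij) (submx_trans _ Uw).
  rewrite -mulmxA; have -> : (1%:M - t i j) *m t c d = t c d *m (1%:M - t i j).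
    by rewrite mulmxBl mulmxBr mul1mx mulmx1 trC.
  by rewrite mulmxA submxMr // sU.
have wkl' := inline _ _ wkl.
(* A fifth point is essential: in the 2-dimensional representation of [S_4] disjoint transpositions
   do act by the same reflection. *)
have [r rX] : exists2 r, r \in X & [/\ r != p, r != q, r != k & r != l].
  have : ~~ (X \subset [:: p; q; k; l]).
    apply: contraL X5 => /subset_leq_card XS; rewrite -leqNgt.
    exact: leq_trans XS (card_size _).
  by case/subsetPn=> r rX; rewrite !inE !negb_or => /and4P[]; exists r.
case=> rp rq rk rl.
have wlr : w *m t l r = - w.
  have [e we] : exists e, w *m t l r = e *: w by apply: (good p q); rewrite // eq_sym.
  have e1 : -1 = e by apply: (@eigen_braid k l r w); rewrite // 1?eq_sym // scaleN1r.
  by rewrite we -e1 scaleN1r.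
have wkr : w *m t k r = - w.
  have [e we] : exists e, w *m t k r = e *: w by apply: (good p q); rewrite // eq_sym.
  have e1 : -1 = e.
    by apply: (@eigen_braid l k r w); rewrite // 1?eq_sym // 1?trS scaleN1r.
  by rewrite we -e1 scaleN1r.
have wlr' := inline _ _ wlr; have wkr' := inline _ _ wkr.
have all_good i j : i \in X -> j \in X -> i != j -> exists e, w *m t i j = e *: w.
  move=> iX jX ij.
  have [/andP[]|/nandP pqij] := boolP ((i \notin [set p; q]) && (j \notin [set p; q])).
    rewrite !inE !negb_or => /andP[ip iq] /andP[jp jq].
    by apply: (good p q); rewrite // eq_sym.
  have [/andP[]|/nandP klij] := boolP ((i \notin [set k; l]) && (j \notin [set k; l])).
    rewrite !inE !negb_or => /andP[ik il] /andP[jk jl].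
    by apply: (good k l); rewrite // eq_sym.
  wlog [iP jP] : i j iX jX ij pqij klij / i \in [set p; q] /\ j \in [set k; l].
    move=> W; case: pqij klij => /negPn ipq [] /negPn jkl.
    - by move: ipq jkl; rewrite !inE => /orP[] /eqP-> /orP[] /eqP e; move: e pk pl qk ql => ->; rewrite eqxx.
    - by apply: W => //; [left | right]; rewrite negbK.
    - by rewrite trS; apply: W; rewrite 1?eq_sym //; [left | right]; rewrite negbK.
    - by move: ipq jkl; rewrite !inE => /orP[] /eqP-> /orP[] /eqP e; move: e pk pl qk ql => ->; rewrite eqxx.
  have ir : i != r by move: iP; rewrite !inE => /orP[]/eqP->; rewrite eq_sym.
  have jr : j != r by move: jP; rewrite !inE => /orP[]/eqP->; rewrite eq_sym.
  have ik : i != k by move: iP; rewrite !inE => /orP[]/eqP->.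
  have il : i != l by move: iP; rewrite !inE => /orP[]/eqP->.
  move: jP; rewrite !inE => /orP[]/eqP jE; subst j.
    by apply: (good l r); rewrite // eq_sym.
  by apply: (good k r); rewrite // eq_sym.
have all_neg i j : i \in X -> j \in X -> i != j -> w *m t i j = - w.
  move: i j; apply: (@pair_transport X (fun i j => w *m t i j = - w) p q) => //.
  - by move=> i j _ _ _; rewrite trS.
  - move=> i j c iX jX cX ij ic jc wij.
    have [e we] := all_good _ _ iX cX ic.
    have e1 : -1 = e.
      by apply: (@eigen_braid j i c w); rewrite // 1?eq_sym // 1?trS scaleN1r.
    by rewrite we -e1 scaleN1r.
  exact: neg.
apply: nU => i j c iX jX cX ij jc ic.
have lineE d e : d \in X -> e \in X -> d != e -> exists D, U *m t d e = U - D *m w.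
  move=> dX eX de; have wde := inline _ _ (all_neg _ _ dX eX de).
  have : (U *m (1%:M - t d e) <= w)%MS.
    by rewrite -(geq_leqif (mxrank_leqif_sup wde)) rank_rV w0 refl_rank.
  by case/submxP=> D DE; exists D; rewrite -DE mulmxBr mulmx1 subKr.
have [D DE] := lineE _ _ iX jX ij; have [E EE] := lineE _ _ jX cX jc.
set z := D *m w - E *m w.
have wcyc : w *m t i j *m t j c = w by rewrite !all_neg // mulNmx all_neg // opprK.
have zcyc : z *m t i j *m t j c = z.
  by rewrite /z -mulmxBl -!mulmxA (mulmxA w) wcyc.
have UE : U *m t i j *m t j c = U + z.
  rewrite DE mulmxBl EE -mulmxA all_neg // mulmxN opprK /z.
  by rewrite -addrA [- _ + _]addrC.
have : U *m t i j *m t j c *m t i j *m t j c *m t i j *m t j c = U.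
  rewrite -!mulmxA; set A := t i j; set B := t j c.
  have -> : A *m (B *m (A *m (B *m (A *m B)))) = 1%:M.
    have E1 : A *m B *m A = t i c by rewrite trB // trK.
    have E2 : B *m A *m B = t i c.
      by rewrite -mulmxA trB2 // mulmxA trI // mul1mx.
    by rewrite -(trI ic) -{1}E1 -E2 !mulmxA.
  by rewrite mulmx1.
move: z zcyc UE => z zcyc UE.
have cycD (V W : 'M[F]_(m, N)) :
    (V + W) *m t i j *m t j c = V *m t i j *m t j c + W *m t i j *m t j c.
  by rewrite !mulmxDl.
rewrite UE cycD UE zcyc !cycD UE zcyc -!addrA => /eqP.
rewrite -subr_eq0 [X in X - _]addrC addrK -mulr2n -mulrS -scaler_nat scaler_eq0.
by rewrite (negPf (natF0 2)) /= => /eqP->; rewrite addr0.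
Qed.


Section Basis.
Variables (p q : T) (w : 'rV[F]_N).
Hypotheses (pX : p \in X) (qX : q \in X) (pq : p != q) (w0 : w != 0).
Hypothesis wpq : (w <= U *m (1%:M - t p q))%MS.
Hypothesis wfix : forall k l, k \in X -> l \in X -> k != l ->
  p != k -> p != l -> q != k -> q != l -> w *m t k l = w.

Let wneg : w *m t p q = - w.
Proof.
have /submxP[D ->] := wpq; rewrite -!mulmxA mulmxBl mul1mx trI //.
by rewrite -opprB !mulmxN.
Qed.

(** The reflection vector of [(p j)], modelled on [e_j - e_p] in the permutation representation. *)
Definition refl_vec j := if j == q then w else w *m t q j.
Local Notation W := refl_vec.

Lemma refl_vec_neg j : j \in X -> p != j -> W j *m t p j = - W j.
Proof.
move=> jX pj; rewrite /W; have [->//|jq] := eqVneq j q.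
have -> : w *m t q j *m t p j = w *m t p q *m t q j.
  by rewrite -!mulmxA (trS p j) trB ?(trS q p) // 1?eq_sym.
by rewrite wneg mulNmx.
Qed.

Lemma refl_vec_fix j k l : j \in X -> k \in X -> l \in X -> k != l -> p != j ->
  p != k -> p != l -> j != k -> j != l -> W j *m t k l = W j.
Proof.
move=> jX kX lX kl pj pk pl jk jl; rewrite /W.
have [jq|jq] := eqVneq j q; first by rewrite wfix // -jq.
wlog lq : k l kX lX kl pk pl jk jl / l != q.
  move=> H; have [lq|lq] := eqVneq l q; last exact: H.
  by rewrite (trS k l); apply: H; rewrite // -?lq // eq_sym.
have [->|kq] := eqVneq k q.
  have -> : w *m t q j *m t q l = w *m t j l *m t q j.
    by rewrite -!mulmxA (trS q j) trB // 1?eq_sym.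
  by rewrite wfix // eq_sym.
by rewrite -mulmxA trC // 1?eq_sym // mulmxA wfix // eq_sym.
Qed.

Lemma refl_vec_swap j k : j \in X -> k \in X -> p != j -> p != k -> j != k ->
  W j *m t j k = W k.
Proof.
move=> jX kX pj pk jk; rewrite /W.
have [jq|jq] := eqVneq j q.
  by rewrite jq in jk *; rewrite eq_sym (negPf jk).
have [->|kq] := eqVneq k q; first by rewrite (trS j q) trK // eq_sym.
by rewrite -mulmxA trB2 // 1?eq_sym // mulmxA wfix // eq_sym.
Qed.

Lemma refl_vec_neq0 j : j \in X -> W j != 0.
Proof.
move=> jX; rewrite /W; have [//|jq] := eqVneq j q.
by apply: contraNneq w0 => w1; rewrite -(@trK _ w q j) 1?eq_sym // w1 mul0mx.
Qed.

Lemma refl_vec_sub j : j \in X -> p != j -> (W j <= U *m (1%:M - t p j))%MS.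
Proof.
move=> jX pj; rewrite /W; have [->//|jq] := eqVneq j q.
apply: submx_trans (submxMr _ wpq) _.
have -> : U *m (1%:M - t p q) *m t q j = U *m t q j *m (1%:M - t p j).
  by rewrite -!mulmxA (trS q j) trB1 // eq_sym.
by rewrite submxMr // sU // eq_sym.
Qed.

(** The image of [1 - t p k] on [U] is the line of [W k], which gives a coefficient for each pair.
    Conjugating by transpositions that fix [p] shows that it is the same for all pairs. *)
Lemma refl_vec_coef : exists be, forall j k, j \in X -> k \in X -> p != j ->
  p != k -> j != k -> W j *m t p k = W j - be *: W k.
Proof.
have : exists2 r, r \in X :\ p & r != q.
  have : (1 < #|X :\ p|)%N.
    by move: X5; rewrite (cardsD1 p) pX add1n ltnS => /(leq_trans _)->.
  case/card_gt1P=> r [s [rX sX rs]]; have [rq|] := eqVneq r q; last by exists r.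
  by exists s => //; rewrite -rq eq_sym.
case=> r; rewrite !inE => /andP[rp rX] rq.
have [be bE] : exists be, W r *m (1%:M - t p q) = be *: W q.
  apply/sub_rVP; have Ws := refl_vec_sub qX pq.
  have Uw : (U *m (1%:M - t p q) <= W q)%MS.
    by rewrite -(geq_leqif (mxrank_leqif_sup Ws)) rank_rV refl_vec_neq0 // refl_rank.
  apply: submx_trans Uw; apply: submxMr.
  rewrite (submx_trans (refl_vec_sub _ _)) // 1?eq_sym // mulmxBr mulmx1.
  by rewrite addmx_sub // eqmx_opp sU // eq_sym.
exists be => j k jX kX pj pk jk.
suff : W j *m (1%:M - t p k) = be *: W k.
  by move <-; rewrite mulmxBr mulmx1 subKr.
have [jY kY] : j \in X :\ p /\ k \in X :\ p.
  by rewrite !inE jX kX ![_ == p]eq_sym pj pk.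
move: j k jY kY jk {jX kX pj pk}; apply: (@pair_transport (X :\ p)
  (fun j k => W j *m (1%:M - t p k) = be *: W k) r q) => //.
- move=> j k; rewrite !inE ![_ == p]eq_sym => /andP[pj jX] /andP[pk kX] jk E.
  rewrite -[W k](@refl_vec_swap j) // -mulmxA trB1 // mulmxA E -scalemxAl.
  by rewrite trS refl_vec_swap // eq_sym.
- move=> i j k; rewrite !inE ![_ == p]eq_sym.
  move=> /andP[pi iX] /andP[pj jX] /andP[pk kX] ij ik jk E.
  rewrite -[W i](@refl_vec_fix i j k) // -mulmxA (trS j k) trB1 // 1?eq_sym //.
  by rewrite mulmxA E -scalemxAl trS refl_vec_swap.
- by rewrite !inE rp.
by rewrite !inE eq_sym pq.
Qed.

(** Writing [(j k)] as [(p j)(p k)(p j)] gives [(1 - be) *: W k = (1 - be ^+ 2) *: W j]. If [be]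
    were not 1, all the vectors [W j] would be proportional; then [W k = W l], while [(k l)] both
    exchanges these two and negates [W k]. *)
Lemma refl_vec_coef1 j k : j \in X -> k \in X -> p != j -> p != k -> j != k ->
  W j *m t p k = W j - W k.
Proof.
have [be bE] := refl_vec_coef.
suff be1 : be = 1 by move=> jX kX pj pk jk; rewrite bE // be1 scale1r.
clear j k.
have two0 : (2%:R : F) != 0 := natF0 1.
apply/eqP/negPn/negP => be1.
have Wk j' k' : j' \in X -> k' \in X -> p != j' -> p != k' -> j' != k' ->
    W k' = (1 + be) *: W j'.
  move=> jX' kX' pj' pk' jk'.
  have E : W j' *m t j' k' = (1 - be ^+ 2) *: W j' + be *: W k'.
    have -> : t j' k' = t p j' *m t p k' *m t p j'.
      by rewrite (trS p j') trB ?(trS j' p) ?trK // 1?eq_sym.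
    rewrite !mulmxA refl_vec_neg // !mulNmx bE // mulmxBl -scalemxAl.
    rewrite refl_vec_neg // bE // 1?eq_sym //.
    rewrite opprB scalerBr scalerA scalerBl scale1r -expr2.
    by rewrite opprK addrC addrA addrAC.
  move: E; rewrite refl_vec_swap // => E.
  apply: (@scalerI _ _ (1 - be)); first by rewrite subr_eq0 eq_sym.
  by rewrite scalerBl scale1r {1}E addrK scalerA; congr (_ *: _); ring.
have /card_gt2P[j [k [l [[jY kY lY] [jk kl lj]]]]] : (2 < #|X :\ p|)%N.
  by move: X5; rewrite (cardsD1 p) pX add1n ltnS => /(leq_trans _)->.
move: jY kY lY; rewrite !inE ![_ == p]eq_sym.
move=> /andP[pj jX] /andP[pk kX] /andP[pl lX].
have lk : W l = W k.
  rewrite -(@refl_vec_swap k l) // (Wk j k) // -scalemxAl refl_vec_fix //.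
  by rewrite eq_sym.
have : W k *m t k l = - W k.
  have -> : t k l = t p k *m t p l *m t p k.
    by rewrite (trS p k) trB ?(trS k p) ?trK // 1?eq_sym.
  by rewrite !mulmxA refl_vec_neg // !mulNmx -{1}lk refl_vec_neg // lk mulNmx
             refl_vec_neg // !opprK.
rewrite refl_vec_swap // lk => /eqP; rewrite -subr_eq0 opprK -mulr2n -scaler_nat.
by rewrite scaler_eq0 (negPf two0) (negPf (refl_vec_neq0 kX)).
Qed.

(** The vectors [W j] with [j != p] are independent: applying [1 - t p k] to a relation with
    coefficients [v] of sum [S] gives [v k = - S] for every [k], and summing over [k] gives
    [#|X| * S = 0]. *)
Lemma refl_basis : (#|X|.-1 <= \rank U)%N.
Proof.
pose Y := X :\ p.
have YE : #|X|.-1 = #|Y| by rewrite (cardsD1 p) pX.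
have YP (i : 'I_#|Y|) : enum_val i \in X /\ p != enum_val i.
  by have := enum_valP i; rewrite !inE eq_sym => /andP[].
pose B := \matrix_(i < #|Y|) W (enum_val i).
have BU : (B <= U)%MS.
  apply/row_subP => i; rewrite rowK; have [iX ip] := YP i.
  rewrite (submx_trans (refl_vec_sub _ _)) // mulmxBr mulmx1.
  by rewrite addmx_sub // eqmx_opp sU.
rewrite YE; apply: leq_trans (mxrankS BU); rewrite -[X in (X <= _)%N]mul1n.
suff : row_free B by rewrite /row_free mul1n => /eqP->.
rewrite -kermx_eq0; apply/rowV0P => v /sub_kermxP vB.
have vS : \sum_i v 0 i *: W (enum_val i) = 0.
  by rewrite -[RHS]vB mulmx_sum_row; apply: eq_bigr => i _; rewrite rowK.
pose S := \sum_i v 0 i.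
have vE k : v 0 k = - S.
  have [kX kp] := YP k.
  have : (\sum_i v 0 i *: W (enum_val i)) *m (1%:M - t p (enum_val k)) = 0.
    by rewrite vS mul0mx.
  rewrite mulmx_suml (eq_bigr (fun i => (v 0 i + (v 0 i *+ (i == k))) *: W (enum_val k))).
    rewrite -scaler_suml big_split /= -/S (bigD1 k) //= eqxx big1 ?addr0; last first.
      by move=> i /negPf->.
    move/eqP; rewrite scaler_eq0 (negPf (refl_vec_neq0 kX)) orbF mulr1n addrC addr_eq0.
    by move/eqP.
  move=> i _; have [iX ip] := YP i; rewrite -scalemxAl mulmxBr mulmx1.
  have [->|ik] := eqVneq i k.
    by rewrite refl_vec_neg // opprK scalerDr scalerDl mulr1n.
  rewrite refl_vec_coef1 ?mulr0n ?addr0 ?subKr // .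
  by apply: contraNneq ik => /enum_val_inj->.
have S0 : S = 0.
  apply/eqP; have : S = - (S *+ #|Y|).
    by rewrite {1}/S (eq_bigr _ (fun i _ => vE i)) sumr_const card_ord mulNrn.
  move/eqP; rewrite -addr_eq0 -mulrS -mulr_natr mulf_eq0.
  by rewrite (negPf (natF0 _)) orbF.
by apply/rowP => k; rewrite vE S0 oppr0 mxE.
Qed.

End Basis.

(** A transposition disjoint from [(a b)] commutes with it, so it acts on the reflection vector [w]
    by a sign; [refl_same_line] excludes the sign -1. *)
Lemma refl_rank_ge : (#|X|.-1 <= \rank U)%N.
Proof.
have /mxrank_le1P[w wU [D UE]] := rab.
have w0 : w != 0.
  by apply: contraNneq (refl_neq0 aX bX ab) => w0; rewrite UE w0 mulmx0.
apply: (@refl_basis a b w) => // k l kX lX kl ak al bk bl.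
have [e we] : exists e, w *m t k l = e *: w.
  apply/sub_rVP; apply: submx_trans (submxMr _ wU) _.
  rewrite -mulmxA; have -> : (1%:M - t a b) *m t k l = t k l *m (1%:M - t a b).
    by rewrite mulmxBl mulmxBr mul1mx mulmx1 trC.
  rewrite mulmxA (@submx_trans _ _ _ _ _ _ (U *m (1%:M - t a b))) //.
    by rewrite submxMr // sU.
  by rewrite UE submxMl.
have /eqP := eigen_sqr kl w0 we; rewrite sqrf_eq1 => /orP[]/eqP e1.
  by rewrite we e1 scale1r.
by case: (@refl_same_line a b k l w) => //; rewrite we e1 scaleN1r.
Qed.

End Reflections.

(* The three nontrivial characters of the Klein four-group are permuted
   transitively, so all of them occur as soon as one does. *)
Lemma klein_rank_ge X m (U : 'M[F]_(m, N)) i j k l : stableT t X U ->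
  i \in X -> j \in X -> k \in X -> l \in X ->
  i != j -> k != l -> i != k -> i != l -> j != k -> j != l ->
  U *m t i j *m t k l != U -> (2 < \rank U)%N.
Proof.
move=> sU iX jX kX lX ij kl ik il jk jl.
pose A := t i j *m t k l; pose B := t i k *m t j l.
have AA : A *m A = 1%:M by rewrite /A mulmxA -[_ *m t i j]mulmxA -trC // mulmxA trI // mul1mx trI.
have BB : B *m B = 1%:M.
  by rewrite /B mulmxA -[_ *m t i k]mulmxA -trC // ?mulmxA ?trI // ?mul1mx ?trI // eq_sym.
have klA : t k l *m A = A *m t k l by rewrite /A mulmxA -trC.
have klB : t k l *m B = t i l *m t j k *m t k l.
  rewrite /B mulmxA (trS k l) (trS i k) (@trB l k i) // 1?eq_sym //.
  rewrite -mulmxA (trS l k) (trS j l) (@trB k l j) // 1?eq_sym //.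
  by rewrite (trS l i) (trS k j) mulmxA.
have jkA : t j k *m A = B *m t j k.
  rewrite /A /B mulmxA (trS j k) (trS i j) (@trB k j i) // 1?eq_sym //.
  by rewrite -mulmxA (trS k j) (@trB j k l) // (trS k i) mulmxA.
have AB : A *m B = t i l *m t j k.
  have e1 : t i j *m t i l = t j l *m t i j by rewrite (trS i j) trB // eq_sym.
  rewrite /A -mulmxA klB !mulmxA e1 -[t j l *m _ *m _]mulmxA (trB2 ij jk ik).
  rewrite !mulmxA -[_ *m t i k *m t k l]mulmxA (trB2 ik kl il).
  rewrite !mulmxA -[t j l *m t j k *m t k l]mulmxA (trB jk kl jl).
  by rewrite !mulmxA trI // mul1mx trC // eq_sym.
have BA : B *m A = A *m B.
  have CC : A *m B *m A *m B = 1%:M.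
    rewrite -mulmxA AB mulmxA -[_ *m t i l]mulmxA -trC //; last 2 first.
    - by rewrite eq_sym.
    - by rewrite eq_sym.
    by rewrite mulmxA trI // mul1mx trI.
  exact: mulmx_invol_comm AA BB CC.
move=> Uc.
have /rowV0Pn[u uU u0] : U *m (1%:M - A) != 0.
  by rewrite mulmxBr mulmx1 subr_eq0 eq_sym /A mulmxA.
have uA : u *m A = - u.
  by have /submxP[D ->] := uU; rewrite -!mulmxA mulmxBl mul1mx AA -opprB !mulmxN.
have {}uU : (u <= U)%MS.
  apply: submx_trans uU _; rewrite mulmxBr mulmx1 addmx_sub // eqmx_opp /A mulmxA.
  by rewrite (submx_trans (submxMr _ (sU _ _ iX jX ij))) // sU.
have tU (x : 'rV_N) a b : a \in X -> b \in X -> a != b -> (x <= U)%MS -> (x *m t a b <= U)%MS.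
  by move=> aX bX ab xU; rewrite (submx_trans (submxMr _ xU)) // sU.
have t0 (x : 'rV_N) a b : a != b -> x != 0 -> x *m t a b != 0.
  by move=> ab; apply: contraNneq => x0; rewrite -(trK x ab) x0 mul0mx.
(* A vector with character [(-1, 1)] on [(A, B)]. If [u] has character [(-1, -1)], then conjugation
   by [(k l)], which exchanges [B] and [A *m B], corrects it. Below, [v2] and [v3] carry the other
   two nontrivial characters. *)
have [v [vU v0 vA vB]] : exists v : 'rV_N, [/\ (v <= U)%MS, v != 0, v *m A = - v & v *m B = v].
  have [uB|uB] := eqVneq (u *m (1%:M + B)) 0.
    have {}uB : u *m B = - u.
      by apply/eqP; rewrite -addr_eq0 addrC -{1}[u]mulmx1 -mulmxDr uB.
    exists (u *m t k l); split; rewrite ?t0 ?tU //.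
      by rewrite -mulmxA klA mulmxA uA mulNmx.
    by rewrite -mulmxA klB -AB (mulmxA u (A *m B)) (mulmxA u A) uA mulNmx uB opprK.
  exists (u *m (1%:M + B)); split=> //.
  - by rewrite mulmxDr mulmx1 addmx_sub // /B mulmxA !tU.
  - by rewrite -mulmxA mulmxDl mul1mx BA -{1}[A]mulmx1 -mulmxDr mulmxA uA mulNmx.
  by rewrite -mulmxA mulmxDl mul1mx BB addrC.
pose v2 := v *m t j k; pose v3 := v *m t k l.
have v2A : v2 *m A = v2 by rewrite /v2 -mulmxA jkA mulmxA vB.
have v3A : v3 *m A = - v3 by rewrite /v3 -mulmxA klA mulmxA vA mulNmx.
have v3B : v3 *m B = - v3 by rewrite /v3 -mulmxA klB -AB (mulmxA v (A *m B)) (mulmxA v A) vA mulNmx vB mulNmx.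
have two0 : (2%:R : F) != 0 := natF0 1.
pose Z := col_mx v (col_mx v2 v3).
have ZU : (Z <= U)%MS by rewrite !col_mx_sub vU !tU.
apply: leq_trans (mxrankS ZU); suff /eqP-> : row_free Z by [].
rewrite -kermx_eq0; apply/rowV0P => x /sub_kermxP.
rewrite -[x]hsubmxK -[rsubmx x]hsubmxK /Z !mul_row_col.
set a := lsubmx x; set b := lsubmx _; set c := rsubmx _.
have sc (y : 'M[F]_1) (z : 'rV_N) : y *m z = y 0 0 *: z.
  by rewrite [y]mx11_scalar mul_scalar_mx mxE.
rewrite !sc => E.
have b0 : b 0 0 = 0.
  have : (a 0 0 *: v + (b 0 0 *: v2 + c 0 0 *: v3)) *m (1%:M + A) = 0 by rewrite E mul0mx.
  rewrite mulmxDr mulmx1 !mulmxDl -!scalemxAl vA v2A v3A !scalerN.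
  rewrite addrACA subrr add0r addrACA subrr addr0 -mulr2n -scaler_nat => /eqP.
  by rewrite !scaler_eq0 (negPf two0) (negPf (t0 _ _ _ jk v0)) orbF => /eqP.
have a0 : a 0 0 = 0.
  have : (a 0 0 *: v + (b 0 0 *: v2 + c 0 0 *: v3)) *m (1%:M + B) = 0 by rewrite E mul0mx.
  rewrite b0 scale0r add0r mulmxDr mulmx1 !mulmxDl -!scalemxAl vB v3B !scalerN.
  rewrite addrACA subrr addr0 -mulr2n -scaler_nat => /eqP.
  by rewrite !scaler_eq0 (negPf two0) (negPf v0) orbF => /eqP.
have c0 : c 0 0 = 0.
  move/eqP: E; rewrite a0 b0 !scale0r !add0r scaler_eq0.
  by rewrite (negPf (t0 _ _ _ kl v0)) orbF => /eqP.
by rewrite [a]mx11_scalar [b]mx11_scalar [c]mx11_scalar a0 b0 c0 !raddf0 !row_mx0.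
Qed.

(** * Descent to the eigenspaces of a transposition *)

Lemma eigen_split m (U : 'M[F]_(m, N)) (s : 'M[F]_N) : s *m s = 1%:M ->
  (U *m s <= U)%MS ->
  (\rank (U *m (1%:M + s)) + \rank (U *m (1%:M - s)) <= \rank U)%N.
Proof.
move=> ss sU; rewrite -mxrank_disjoint_sum.
  apply: mxrankS; rewrite addsmx_sub !(mulmxDr, mulmxN) mulmx1.
  by rewrite !addmx_sub // eqmx_opp.
apply/eqP/rowV0P => v; rewrite sub_capmx => /andP[/submxP[D DE] /submxP[E EE]].
have v1 : v *m s = v by rewrite DE -!mulmxA mulmxDl mul1mx ss addrC.
have : v *m s = - v by rewrite EE -!mulmxA mulmxBl mul1mx ss -opprB !mulmxN.
rewrite v1 => /eqP; rewrite -subr_eq0 opprK -mulr2n -scaler_nat scaler_eq0.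
by rewrite (negPf (natF0 1)) => /eqP.
Qed.

Lemma eigen_split_neq m (U : 'M[F]_(m, N)) (s c : 'M[F]_N) : U *m c != U ->
  U *m (1%:M + s) *m c != U *m (1%:M + s) \/ U *m (1%:M - s) *m c != U *m (1%:M - s).
Proof.
move=> Uc; apply/orP; rewrite -negb_and; apply: contraNN Uc => /andP[/eqP E1 /eqP E2].
have UE : U = 2%:R^-1 *: (U *m (1%:M + s) + U *m (1%:M - s)).
  rewrite -mulmxDr addrACA subrr addr0 -mulr2n -scaler_nat -scalemxAr mulmx1.
  by rewrite scalerA mulVf ?scale1r // (natF0 1).
by rewrite {1}UE -scalemxAl mulmxDl E1 E2 -UE.
Qed.

Lemma stableT_eigen X Y m (U : 'M[F]_(m, N)) a b : stableT t X U ->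
  a \notin Y -> b \notin Y -> a != b -> Y \subset X ->
  stableT t Y (U *m (1%:M + t a b)) /\ stableT t Y (U *m (1%:M - t a b)).
Proof.
move=> sU aY bY ab YX.
have key e : stableT t Y (U *m (1%:M + e *: t a b)).
  move=> i j iY jY ij.
  have [ai aj bi bj] : [/\ a != i, a != j, b != i & b != j].
    by split; [apply: contraNneq aY | apply: contraNneq aY
              |apply: contraNneq bY | apply: contraNneq bY] => ->.
  have -> : U *m (1%:M + e *: t a b) *m t i j = U *m t i j *m (1%:M + e *: t a b).
    rewrite -!mulmxA; congr (_ *m _).
    by rewrite mulmxDl mulmxDr mul1mx mulmx1 -scalemxAl -scalemxAr trC.
  by rewrite submxMr // sU // (subsetP YX).
by have := key 1; have := key (-1); rewrite scale1r scaleN1r.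
Qed.

End Relations.

(** If both eigenspaces of [(a b)] have rank at least 2, the ranks add up to at least
    [(#|X| - 3) + 2]. Otherwise [t a b] or its negative is a reflection on [U], and the previous
    part applies, after a twist by the sign in the second case. *)
Lemma transp_rank_step t X m (U : 'M[F]_(m, N)) a b : [pchar F] =i pred0 ->
  transp_rel t -> (4 < #|X|)%N -> stableT t X U -> ~ triv3 t X U ->
  a \in X -> b \in X -> a != b ->
  (#|X| - 3 <= \rank (U *m (1%:M + t a b)))%N \/
  (#|X| - 3 <= \rank (U *m (1%:M - t a b)))%N -> (#|X|.-1 <= \rank U)%N.
Proof.
move=> F0 tR X5 sU nU aX bX ab rk.
have rs := eigen_split F0 (trI tR ab) (sU _ _ aX bX ab).
have [rp|rp] := leqP (\rank (U *m (1%:M + t a b))) 1.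
  apply: (@refl_rank_ge (fun i j => - t i j) (transp_relN tR) F0 X m U a b) => //.
  - by move=> i j iX jX ij; rewrite mulmxN eqmx_opp sU.
  - move=> nU'; apply: nU => i j k iX jX kX ij jk ik.
    by rewrite -{2}(nU' i j k) // !(mulmxN, mulNmx) opprK.
  - by rewrite opprK.
have [rm|rm] := leqP (\rank (U *m (1%:M - t a b))) 1.
  exact: (@refl_rank_ge t tR F0 X m U a b).
by case: rk => rk; lia.
Qed.

(** Induction on [#|X|]: for at least six points, [(a b)] is taken off [i, j, k, l], and one of its
    eigenspaces is a nontrivial representation for the [#|X| - 2] remaining points. Four points are
    the Klein group case. *)
Lemma transp_rank_ge t X m (U : 'M[F]_(m, N)) i j k l : [pchar F] =i pred0 ->
  transp_rel t -> stableT t X U ->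
  i \in X -> j \in X -> k \in X -> l \in X ->
  i != j -> k != l -> i != k -> i != l -> j != k -> j != l ->
  U *m t i j *m t k l != U -> (#|X|.-1 <= \rank U)%N.
Proof.
move=> F0 tR; have [n] := ubnP #|X|; elim: n => // n IH in X m U i j k l *.
rewrite ltnS => Xn sU iX jX kX lX ij kl ik il jk jl Uc.
have nU : ~ triv3 t X U.
  move/(triv3_triv22 tR) => U22; case/eqP: Uc; exact: U22.
have [X4|X5] := leqP #|X| 4.
  apply: leq_trans (klein_rank_ge tR F0 sU iX jX kX lX ij kl ik il jk jl Uc).
  by case: #|X| X4 => // -[|[|[|[]]]].
have [X5'|X6] := leqP #|X| 5.
  have {X5 X5'}X5 : #|X| = 5 by lia.
  (* With five points only one lies off [i, j, k, l], so a nontrivial 3-cycle replaces the double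
     transposition and [(a b)] moves the two points left. The eigenspace on which the 3-cycle is
     nontrivial has rank at least [2 = 5 - 3], since 3-cycles are trivial on a line. *)
  have [i' [j' [k' [[iX' jX' kX'] [ij' jk' ik'] Uc']]]] : exists i' j' k',
      [/\ [/\ i' \in X, j' \in X & k' \in X], [/\ i' != j', j' != k' & i' != k']
       & U *m t i' j' *m t j' k' != U].
    have [E1|] := eqVneq (U *m t i j *m t j k) U; last by exists i, j, k.
    have [E2|] := eqVneq (U *m t j k *m t k l) U; last by exists j, k, l.
    by case/eqP: Uc; rewrite -[U *m t i j](@trK t tR _ _ j k) // E1 E2.
  have [a [b [[aX bX ab] /andP[aS bS]]]] : exists a b, [/\ a \in X, b \in X & a != b] /\
      (a \notin [:: i'; j'; k']) && (b \notin [:: i'; j'; k']).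
    by apply: two_outside; rewrite X5.
  apply: (@transp_rank_step t X m U a b) => //; first by rewrite X5.
  pose Z := [set x in [:: i'; j'; k']].
  have ZX : Z \subset X.
    by apply/subsetP => x; rewrite !inE => /or3P[] /eqP->.
  have [sp sm] : stableT t Z (U *m (1%:M + t a b)) /\ stableT t Z (U *m (1%:M - t a b)).
    by apply: stableT_eigen sU _ _ ab ZX => //; rewrite in_set.
  have rk2 (V : 'M[F]_(m, N)) : stableT t Z V -> V *m (t i' j' *m t j' k') != V ->
      (#|X| - 3 <= \rank V)%N.
    move=> sV Vc; rewrite X5 leqNgt ltnS; apply/negP => rV; case/eqP: Vc.
    by rewrite mulmxA (rank1_triv3 tR sV) // !inE eqxx ?orbT.
  rewrite -mulmxA in Uc'.
  by case: (eigen_split_neq F0 (t a b) Uc') => Vc; [left | right]; apply: rk2.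
have [a [b [[aX bX ab] /andP[aS bS]]]] := @two_outside _ X [:: i; j; k; l] X6.
apply: (@transp_rank_step t X m U a b) => //.
pose Z := X :\: [set a; b].
have ZX : Z \subset X by apply: subsetDl.
have [sp sm] : stableT t Z (U *m (1%:M + t a b)) /\ stableT t Z (U *m (1%:M - t a b)).
  by apply: stableT_eigen sU _ _ ab ZX => //; rewrite !inE eqxx ?orbT.
have cZ : #|Z| = (#|X| - 2)%N.
  have /setIidPr E : [set a; b] \subset X.
    by apply/subsetP => x; rewrite !inE => /orP[] /eqP->.
  by rewrite cardsD E cards2 ab.
move: aS bS; rewrite !inE !negb_or => /and4P[ai aj ak al] /and4P[bi bj bk bl].
have inZ x : x \in X -> a != x -> b != x -> x \in Z.
  by move=> xX ax bx; rewrite !inE xX ![x == _]eq_sym (negPf ax) (negPf bx).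
have rkZ (V : 'M[F]_(m, N)) : stableT t Z V -> V *m (t i j *m t k l) != V ->
    (#|X| - 3 <= \rank V)%N.
  move=> sV Vc; have -> : (#|X| - 3 = #|Z|.-1)%N by rewrite cZ -subnS.
  apply: (IH Z m V i j k l) => //; try exact: inZ.
    by rewrite cZ (leq_trans _ Xn) // ltn_subrL (leq_trans _ X6).
  by rewrite -mulmxA.
rewrite -mulmxA in Uc.
by case: (eigen_split_neq F0 (t a b) Uc) => Vc; [left | right]; apply: rkZ.
Qed.
End TranspositionOperators.

(** * Elimination by dimension count *)

Lemma digits_inj (B n : nat) (a b : 'I_n -> nat) :
  (forall i, a i < B)%N -> (forall i, b i < B)%N ->
  (\sum_i a i * B ^ i = \sum_i b i * B ^ i)%N -> a =1 b.
Proof.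
elim: n a b => [|n IH] a b aB bB; first by move=> _ [].
have B0 : (0 < B)%N by apply: leq_ltn_trans (aB ord0).
rewrite !big_ord_recl !muln1.
have sE (f : 'I_n.+1 -> nat) : (\sum_(i < n) f (lift ord0 i) * B ^ lift ord0 i =
    (\sum_(i < n) f (lift ord0 i) * B ^ i) * B)%N.
  by rewrite big_distrl; apply: eq_bigr => i _; rewrite /= /bump /= add1n expnSr mulnA.
rewrite !sE => E.
have E0 : a ord0 = b ord0.
  by have := congr1 (modn^~ B) E; rewrite /= ![(_ + _ * B)%N]addnC !modnMDl !modn_small.
have E1 : (\sum_(i < n) a (lift ord0 i) * B ^ i = \sum_(i < n) b (lift ord0 i) * B ^ i)%N.
  by move: E; rewrite E0 => /addnI/eqP; rewrite eqn_pmul2r // => /eqP.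
move=> i; case: (unliftP ord0 i) => [j|] -> //.
by apply: (IH (fun j => a (lift ord0 j)) (fun j => b (lift ord0 j))).
Qed.

Lemma mnm_lt_msize (R : nzRingType) n (p : {mpoly R[n]}) m i :
  m \in msupp p -> (m i < msize p)%N.
Proof.
move/msize_mdeg_lt; apply: leq_ltn_trans.
by rewrite mdegE (bigD1 i) //= leq_addr.
Qed.

(* Kronecker substitution [x_i := X ^ (B ^ i)] reduces to one variable. *)
Lemma mpoly_nonroot (K : fieldType) n (g : {mpoly K[n]}) :
  [pchar K] =i pred0 -> g != 0 -> exists c : 'I_n -> K, g.@[c] != 0.
Proof.
move=> K0 g0; pose B := msize g; pose wt (m : 'X_{1..n}) := (\sum_i m i * B ^ i)%N.
pose p : {poly K} := mmap polyC (fun i : 'I_n => 'X^(B ^ i)%N) g.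
have pE : p = \sum_(m <- msupp g) (g@_m)%:P * 'X^(wt m).
  apply: eq_bigr => m _; congr (_ * _); rewrite /mmap1 /wt.
  rewrite (big_morph (fun k => 'X^k) (exprD _) (expr0 _)).
  by apply: eq_bigr => i _; rewrite -exprM mulnC.
have p0 : p != 0.
  have [m0 m0g] : exists m0, m0 \in msupp g.
    by exists (mlead g); apply: mlead_supp.
  apply/eqP => /(congr1 (fun r : {poly K} => r`_(wt m0))).
  rewrite coef0 pE coef_sum (bigD1_seq m0) ?msupp_uniq //= coefCM coefXn eqxx mulr1.
  rewrite big_seq_cond big1 ?addr0; first by apply/eqP; rewrite -mcoeff_msupp.
  move=> m /andP[mg mm]; rewrite coefCM coefXn; case: eqP => [E|]; last by rewrite mulr0.
  case/eqP: mm; apply/mnmP/(@digits_inj B) => [i|i|]; rewrite -?E //; exact: mnm_lt_msize.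
have [s ps] : exists s : nat, p.[s%:R] != 0.
  have /allPn[x] : ~~ all (root p) [seq s%:R | s <- iota 0 (size p)].
    apply/negP => /(max_poly_roots p0) => /(_ _); rewrite size_map size_iota ltnn.
    move=> H; suff: false by []; apply: H; rewrite map_inj_uniq ?iota_uniq //.
    move=> a b; wlog ab : a b / (a <= b)%N.
      by move=> W E; case/orP: (leq_total a b) => ab; [|symmetry]; apply: W.
    move/eqP; rewrite eq_sym -subr_eq0 -natrB //; have /pcharf0P-> := K0.
    by rewrite subn_eq0 => ba; apply/eqP; rewrite eqn_leq ab.
  by case/mapP=> s _ ->; rewrite rootE; exists s.
exists (fun i => s%:R ^+ (B ^ i)%N); move: ps; rewrite pE mevalE horner_sum.
congr (_ != 0); apply: eq_bigr => m _; rewrite hornerCM hornerXn; congr (_ * _).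
rewrite /wt (big_morph (fun k => (s%:R : K) ^+ k) (exprD _) (expr0 _)).
by apply: eq_bigr => i _; rewrite -exprM mulnC.
Qed.

Definition mdeg_le (R : nzRingType) n d (p : {mpoly R[n]}) :=
  forall m, m \in msupp p -> (mdeg m <= d)%N.

Lemma mdeg_leM (R : nzRingType) n d e (p r : {mpoly R[n]}) :
  mdeg_le d p -> mdeg_le e r -> mdeg_le (d + e) (p * r).
Proof.
move=> pd re m /msuppM_le /allpairsP[[m1 m2] /= [m1p m2r ->]].
by rewrite mdegD leq_add // ?pd ?re.
Qed.

Lemma mdeg_le1 (R : nzRingType) n : mdeg_le 0 (1 : {mpoly R[n]}).
Proof. by move=> m; rewrite -mpolyC1 msupp1 inE => /eqP->; rewrite mdeg0. Qed.

Lemma mdeg_leX (R : nzRingType) n d (p : {mpoly R[n]}) k :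
  mdeg_le d p -> mdeg_le (k * d) (p ^+ k).
Proof.
move=> pd; elim: k => [|k IH]; first exact: mdeg_le1.
by rewrite exprS mulSn; apply: mdeg_leM.
Qed.

Lemma mdeg_le_prod (R : nzRingType) n (I : Type) (r : seq I)
    (F : I -> {mpoly R[n]}) (d : I -> nat) :
  (forall i, mdeg_le (d i) (F i)) -> mdeg_le (\sum_(i <- r) d i) (\prod_(i <- r) F i).
Proof.
move=> Fd; elim: r => [|i r IH]; first by rewrite !big_nil; apply: mdeg_le1.
by rewrite !big_cons; apply: mdeg_leM.
Qed.

Lemma exp_sub_bound (M s q : nat) : (M ^ q <= (M - s) ^ q + q * s * M ^ q.-1)%N.
Proof.
elim: q => [|q IH]; first by rewrite !expn0 leq_addr.
case: q IH => [|q] IH; first by rewrite !expn1 muln1 mul1n; lia.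
rewrite (expnS M q.+1) (expnS (M - s) q.+1) /= in IH *.
have H1 : (M * M ^ q.+1 <= M * ((M - s) ^ q.+1 + q.+1 * s * M ^ q))%N.
  by rewrite leq_mul2l IH orbT.
apply: leq_trans H1 _.
have H2 : (M * (M - s) ^ q.+1 <= (M - s) * (M - s) ^ q.+1 + s * M ^ q.+1)%N.
  apply: (@leq_trans ((M - s + s) * (M - s) ^ q.+1)%N).
    by rewrite leq_mul2r; apply/orP; right; lia.
  by rewrite mulnDl leq_add2l leq_mul2l leq_exp2r // leq_subr orbT.
have -> : (q.+2 * s * M ^ q.+1 = s * M ^ q.+1 + M * (q.+1 * s * M ^ q))%N.
  by rewrite [(M ^ q.+1)%N]expnS; nia.
by rewrite mulnDr addnA leq_add2r.
Qed.

(** Shrinking a box of side [E * N] by [s] loses only [O(N ^ q.-1)] of its points, fewer than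
    [N ^ q] for large [N]. This is the strict inequality that forces a linear relation in
    [elimination]. *)
Lemma box_count (q s E : nat) : exists2 N, (0 < N)%N &
  ((E * N) ^ q < N ^ q + (E * N - s) ^ q)%N.
Proof.
case: q => [|q]; first by exists 1%N.
exists (q.+1 * s * E ^ q).+1 => //; set N := _.+1.
apply: leq_ltn_trans (exp_sub_bound _ s _) _; rewrite addnC ltn_add2r /=.
by rewrite expnMn mulnA [X in (_ < X)%N]expnS ltn_pmul2r ?expn_gt0.
Qed.

Section Elimination.
Variables (K : fieldType) (q : nat).
Variables (P : 'I_q -> {mpoly K[q]}) (D h : {mpoly K[q]}).
Hypothesis h0 : h != 0.

Let bmon N (b : {ffun 'I_q -> 'I_N}) : 'X_{1..q} := [multinom nat_of_ord (b i) | i < q].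

Let bmon_inj N : injective (@bmon N).
Proof.
move=> a b /mnmP E; apply/ffunP => i; apply/val_inj.
by have := E i; rewrite !mnmE.
Qed.

(* Dimension count: the numerators of the monomials of exponents [< N] in [q]
   unknowns lie in a box of side [O(N)], where the multiples of [h] have
   codimension [O(N ^ (q - 1))]; so some combination is a multiple of [h]. *)
Lemma elimination : exists2 g : {mpoly K[q]}, g != 0 &
  forall (L : fieldType) (iota : {rmorphism K -> L}) (z : 'I_q -> L) (c : 'I_q -> K),
  mmap iota z h = 0 -> mmap iota z D != 0 ->
  (forall l, iota (c l) * mmap iota z D = mmap iota z (P l)) -> g.@[c] = 0.
Proof.
(* [e] bounds the degrees of [D] and of all [P l], so the numerators [T b] have degree at most
   [q * N * e]. The successor in [(e * q).+1] makes their exponents strictly smaller than [M]. *)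
pose e := (\max_l msize (P l) + msize D)%N; pose s := msize h.
have [N N0 cnt] := box_count q s (e * q).+1.
set M := (_ * N)%N in cnt.
pose T (b : {ffun 'I_q -> 'I_N}) : {mpoly K[q]} :=
  D ^+ (q * N - \sum_i b i) * \prod_i P i ^+ b i.
have sb (b : {ffun 'I_q -> 'I_N}) : (\sum_i b i <= q * N)%N.
  rewrite -[q in X in (_ <= X)%N]card_ord -sum_nat_const leq_sum // => i _.
  exact/ltnW/ltn_ord.
have Pe l : mdeg_le e (P l).
  move=> m /msize_mdeg_lt/ltnW/leq_trans; apply.
  exact: leq_trans (@leq_bigmax _ (fun l => msize (P l)) l) (leq_addr _ _).
have De : mdeg_le e D.
  by move=> m /msize_mdeg_lt/ltnW/leq_trans; apply; rewrite leq_addl.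
have Tbox b m i : m \in msupp (T b) -> (m i < M)%N.
  have /[apply] : mdeg_le ((q * N - \sum_i b i) * e + \sum_i b i * e) (T b).
    apply: mdeg_leM; first exact: mdeg_leX.
    by apply: mdeg_le_prod => l; apply: mdeg_leX.
  rewrite -big_distrl /= -mulnDl subnK // => mm.
  have mi : (m i <= mdeg m)%N by rewrite mdegE (bigD1 i) //= leq_addr.
  by rewrite /M mulSn (mulnC e) -mulnA (mulnC e) mulnA; lia.
have hbox (b : {ffun 'I_q -> 'I_(M - s)}) m i :
    m \in msupp (h * 'X_[bmon b]) -> (m i < M)%N.
  case/msuppM_le/allpairsP=> [[m1 m2]] /= [m1h]; rewrite msuppX inE => /eqP-> ->.
  by rewrite mnmDE mnmE; have := mnm_lt_msize i m1h; have := ltn_ord (b i); rewrite -/s; lia.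
pose I1 := {ffun 'I_q -> 'I_N}; pose I2 := {ffun 'I_q -> 'I_(M - s)}.
pose I3 := {ffun 'I_q -> 'I_M}.
pose A1 := \matrix_(i < #|I1|, j < #|I3|) (T (enum_val i))@_(bmon (enum_val j)).
pose A2 := \matrix_(i < #|I2|, j < #|I3|)
   (h * 'X_[bmon (enum_val i)])@_(bmon (enum_val j)).
have /rowV0Pn[v /sub_kermxP vA v0] : kermx (col_mx A1 A2) != 0.
  rewrite kermx_eq0 /row_free neq_ltn; apply/orP; left.
  apply: leq_ltn_trans (rank_leq_col _) _.
  by rewrite !card_ffun !card_ord.
pose Q1 := \sum_i lsubmx v 0 i *: T (enum_val i).
pose u := \sum_i rsubmx v 0 i *: 'X_[bmon (enum_val i)] : {mpoly K[q]}.
have QE : Q1 + h * u = 0.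
  apply/mpolyP => m; rewrite mcoeff0 /u mulr_sumr mcoeffD !raddf_sum /=.
  have [j jm|nbox] := pickP (fun j : I3 => bmon j == m).
    have := congr1 (fun w : 'rV_#|I3| => w 0 (enum_rank j)) vA.
    rewrite -{1}[v]hsubmxK mul_row_col mxE [in X in _ = X]mxE => E; rewrite -[RHS]E.
    congr (_ + _); rewrite mxE; apply: eq_bigr => i _.
      by rewrite mcoeffZ [A1 _ _]mxE enum_rankK (eqP jm).
    by rewrite -scalerAr mcoeffZ [A2 _ _]mxE enum_rankK (eqP jm).
  have out (p : {mpoly K[q]}) :
      (forall m' i, m' \in msupp p -> (m' i < M)%N) -> p@_m = 0.
    move=> pb; apply/eqP; rewrite mcoeff_eq0; apply/negP => mp.
    pose j : I3 := [ffun i => Ordinal (pb m i mp)].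
    have /eqP[] := nbox j; apply/mnmP => i.
    by rewrite mnmE ffunE.
  rewrite !big1 ?addr0 // => i _; rewrite ?(=^~ scalerAr) mcoeffZ out ?mulr0 // => m' k.
    exact: hbox.
  exact: Tbox.
pose g := \sum_i lsubmx v 0 i *: 'X_[bmon (enum_val i)] : {mpoly K[q]}.
have coef0 k N' (f : 'I_k -> {ffun 'I_q -> 'I_N'}) (a : 'I_k -> K) : injective f ->
    \sum_i a i *: 'X_[bmon (f i)] = 0 :> {mpoly K[q]} -> forall i, a i = 0.
  move=> fi E i; have := congr1 (mcoeff (bmon (f i))) E.
  rewrite mcoeff0 raddf_sum /= (bigD1 i) //= big1 ?addr0.
    by rewrite mcoeffZ mcoeffX eqxx mulr1.
  move=> j ji; rewrite mcoeffZ mcoeffX; case: eqP => [/bmon_inj/fi E'|]; last by rewrite mulr0.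
  by rewrite E' eqxx in ji.
(* If [g] vanished, the relation would reduce to [h * u = 0], so [u = 0] and all of [v] would be
   zero. *)
exists g.
  apply: contra_neq v0 => g0.
  have l0 := coef0 _ _ _ _ (@enum_val_inj _ _) g0.
  have /eqP : h * u = 0.
    by move: QE; rewrite /Q1 big1 ?add0r // => i _; rewrite l0 scale0r.
  rewrite mulf_eq0 (negPf h0) => /= /eqP u0.
  have r0 := coef0 _ _ _ _ (@enum_val_inj _ _) u0.
  rewrite -[v]hsubmxK; apply/rowP => i; rewrite !mxE.
  by case: splitP => j _; rewrite ?l0 ?r0.
move=> L iota z c hz Dz cP; apply/eqP; rewrite -(fmorph_eq0 iota).
have : (mmap iota z D) ^+ (q * N) * iota g.@[c] = 0.
  have <- : mmap iota z Q1 = 0.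
    by move/eqP: QE; rewrite addr_eq0 => /eqP->; rewrite mmapN rmorphM /= hz mul0r oppr0.
  have -> : g.@[c] = \sum_i lsubmx v 0 i * \prod_l c l ^+ bmon (enum_val i) l.
    by rewrite /g raddf_sum; apply: eq_bigr => i _ /=; rewrite mevalZ mevalX.
  rewrite /Q1 rmorph_sum raddf_sum /= mulr_sumr; apply: eq_bigr => i _.
  rewrite mmapZ rmorphM /= mulrCA; congr (_ * _).
  rewrite /T rmorphM rmorphXn /= rmorph_prod -{1}(subnK (sb (enum_val i))) exprD.
  rewrite -mulrA; congr (_ * _); rewrite rmorph_prod expr_sum -big_split /=.
  apply: eq_bigr => l _; rewrite mnmE [RHS]rmorphXn /= -cP rmorphXn /= exprMn.
  by rewrite mulrC.
by move/eqP; rewrite mulf_eq0 expf_eq0 (negPf Dz) andbF.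
Qed.
End Elimination.

(** * Points with coordinates roots of unity *)

(* [g] is the norm of the generic [f] from the group algebra [K[c][(Z/(M+1))^n]],
   in which a monomial is a unit. *)
Lemma root_of_unity_locus (K : fieldType) n (A : seq 'X_{1..n}) M : A != [::] ->
  exists2 g : {mpoly K[size A]}, g != 0 &
  forall (L : fieldType) (iota : {rmorphism K -> L})
    (c : 'I_(size A) -> K) (x : 'I_n -> L),
  (forall i, x i ^+ M.+1 = 1) ->
  \sum_(l < size A) iota (c l) * mmap1 x (nth 0%MM A l) = 0 -> g.@[c] = 0.
Proof.
move=> A0; set q := size A; have q0 : (0 < q)%N by rewrite lt0n size_eq0.
pose I := {ffun 'I_n -> 'I_M.+1}.
pose shift (u : I) (b : 'X_{1..n}) : I := [ffun i => inord ((u i + b i) %% M.+1)].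
have shiftE u b i : shift u b i = ((u i + b i) %% M.+1)%N :> nat.
  by rewrite ffunE inordK // ltn_mod.
have shift_inj b : injective (shift^~ b).
  move=> u v E; apply/ffunP => i; apply/val_inj/eqP.
  have /eqP : nat_of_ord (shift u b i) = shift v b i by rewrite [shift u b]E.
  by rewrite !shiftE eqn_modDr !modn_small.
pose G : 'M[{mpoly K[q]}]_#|I| := \matrix_(u, v)
  \sum_l 'X_l * (shift (enum_val u) (nth 0%MM A l) == enum_val v)%:R.
exists (\det G).
  (* For a single monomial with coefficient 1, [G] specialises to a permutation matrix. *)
  pose l0 := Ordinal q0; pose c (l : 'I_q) : K := (l == l0)%:R.
  have : \det (map_mx (meval c) G) != 0.
    apply/det0P => -[w w0 wG]; case/eqP: w0; apply/rowP => u.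
    pose v := enum_rank (shift (enum_val u) (nth 0%MM A l0)).
    have := congr1 (fun z : 'rV_#|I| => z 0 v) wG; rewrite !mxE => E; rewrite -[RHS]E.
    have GE u' : (map_mx (meval c) G) u' v = (u' == u)%:R.
      rewrite !mxE raddf_sum (bigD1 l0) //= big1 ?addr0.
        rewrite mevalM mevalXU /c eqxx mul1r enum_rankK raddfMn /= meval1.
        by rewrite (inj_eq (@shift_inj _)) (inj_eq enum_val_inj).
      by move=> l ll0; rewrite mevalM mevalXU /c (negPf ll0) mul0r.
    rewrite (bigD1 u) //= GE eqxx mulr1 big1 ?addr0 // => u' u'u.
    by rewrite GE (negPf u'u) mulr0.
  by rewrite det_map_mx; apply: contra_neq => ->; rewrite raddf0.
move=> L iota c x xM f0; apply/eqP; rewrite -(fmorph_eq0 iota) -!det_map_mx -det_tr.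
(* The values [x ^ u] depend only on [u] modulo [M.+1]. Multiplication by [f] scales this vector by
   [f(x) = 0], so it lies in the kernel. *)
pose y (u : I) := \prod_i x i ^+ u i.
have yS u b : y (shift u b) = y u * mmap1 x b.
  rewrite /y /mmap1 -big_split; apply: eq_bigr => i _ /=; rewrite shiftE -exprD.
  by rewrite [in RHS](divn_eq (u i + b i) M.+1) exprD mulnC exprM xM expr1n mul1r.
apply/det0P; exists (\row_u y (enum_val u)).
  apply/eqP => /rowP/(_ (enum_rank [ffun=> ord0])); rewrite !mxE enum_rankK /y.
  by rewrite big1 => [/eqP|i _]; rewrite ?oner_eq0 // ffunE expr0.
apply/rowP => u; rewrite !mxE.
transitivity (y (enum_val u) * \sum_l iota (c l) * mmap1 x (nth 0%MM A l)); last first.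
  by rewrite f0 mulr0.
rewrite mulr_sumr.
have GE v : iota (G u v).@[c] =
    \sum_(l < q) iota (c l) * (shift (enum_val u) (nth 0%MM A l) == enum_val v)%:R.
  have -> : (G u v).@[c] =
      \sum_(l < q) c l * (shift (enum_val u) (nth 0%MM A l) == enum_val v)%:R.
    rewrite mxE raddf_sum; apply: eq_bigr => l _ /=.
    by rewrite mevalM mevalXU raddfMn /= meval1.
  by rewrite rmorph_sum; apply: eq_bigr => l _; rewrite rmorphM rmorph_nat.
transitivity (\sum_v y (enum_val v) * iota (G u v).@[c]).
  by apply: eq_bigr => v _; rewrite !mxE.
under eq_bigr => v _ do rewrite GE mulr_sumr.
rewrite exchange_big /=; apply: eq_bigr => l _.
rewrite (bigD1 (enum_rank (shift (enum_val u) (nth 0%MM A l)))) //= big1 ?addr0.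
  by rewrite enum_rankK eqxx mulr1 yS mulrAC mulrA.
move=> v vE; case: eqP => [E|_]; last by rewrite !mulr0.
by rewrite E enum_valK eqxx in vE.
Qed.

(** * Minors of the orbit system *)

Lemma row_free_rowsub (F : fieldType) m n r (B : 'M[F]_(m, n)) (f : 'I_r -> 'I_m) :
  row_free B -> injective f -> row_free (rowsub f B).
Proof.
move=> Bf fi; rewrite -kermx_eq0; apply/rowV0P => v /sub_kermxP vB.
pose w : 'rV_m := \sum_i v 0 i *: delta_mx 0 (f i).
have wB : w *m B = 0 *m B.
  rewrite mul0mx -vB mulmx_suml mulmx_sum_row; apply: eq_bigr => i _.
  by rewrite -scalemxAl -rowE row_rowsub.
have {wB}w0 : w = 0 by apply: (row_free_inj Bf).
apply/rowP => i; have := congr1 (fun z : 'rV_m => z 0 (f i)) w0.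
rewrite /w summxE (bigD1 i) //= !mxE eqxx eqxx mulr1 big1 ?addr0 // => j ji.
by rewrite !mxE (inj_eq fi) eq_sym (negPf ji) andbF mulr0.
Qed.

Lemma minor_of_rank (F : fieldType) m n r (B : 'M[F]_(m, n)) : (r <= \rank B)%N ->
  exists (f : 'I_r -> 'I_m) (g : 'I_r -> 'I_n), injective g /\ \det (mxsub f g B) != 0.
Proof.
move=> rB; pose f := maxrankfun B \o widen_ord rB.
have fB : row_free (rowsub f B).
  rewrite rowsub_comp; apply: row_free_rowsub (maxrowsub_free B) _.
  by move=> i j /(congr1 val) /= /val_inj.
pose C := (rowsub f B)^T.
have rC : \rank C = r by rewrite mxrank_tr; apply/eqP.
pose g := maxrankfun C \o cast_ord (esym rC).
have gi : injective g by move=> i j /maxrankfun_inj/cast_ord_inj.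
exists f, g; split=> //.
have gC : row_free (rowsub g C).
  by rewrite rowsub_comp; apply: row_free_rowsub (maxrowsub_free C) (@cast_ord_inj _ _ _).
have : mxsub f g B = (rowsub g C)^T.
  by apply/matrixP => i j; rewrite !mxE.
by move->; rewrite det_tr -unitfE -unitmxE -row_free_unit.
Qed.

Section Stratum.
Variables (K : fieldType) (n' : nat) (A : seq 'X_{1..n'.+1}).
Local Notation n := n'.+1.
Local Notation q := (size A).
Local Notation am l := (nth 0%MM A l).

Definition orbit_zero (L : fieldType) (iota : {rmorphism K -> L}) (c : 'I_q -> K)
    (x : 'I_n -> L) :=
  forall s : 'S_n, \sum_(l < q) iota (c l) * mmap1 (fun i => x (s i)) (am l) = 0.

(** A square submatrix of the orbit system: [R] selects the equations, [C] the unknown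
    coefficients. *)
Definition mon_mx (S : comNzRingType) r (x : 'I_n -> S) (R : 'I_r -> 'S_n)
    (C : 'I_r -> 'I_q) : 'M[S]_r :=
  \matrix_(i, j) mmap1 (fun a => x (R i a)) (am (C j)).

Lemma map_mon_mx (S S' : comNzRingType) (f : {rmorphism S -> S'}) r
    (x : 'I_n -> S) (R : 'I_r -> 'S_n) (C : 'I_r -> 'I_q) :
  map_mx f (mon_mx x R C) = mon_mx (fun i => f (x i)) R C.
Proof.
apply/matrixP => i j; rewrite !mxE rmorph_prod; apply: eq_bigr => a _.
exact: rmorphXn.
Qed.

Section Slots.
Variables (r : nat) (R : 'I_r -> 'S_n) (C : 'I_r -> 'I_q).
Hypotheses (rn : (n' <= r)%N) (Ci : injective C).

(* The coefficients indexed by [C] are solved for by Cramer's rule, which frees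
   their slots for the coordinates [x_1, ..., x_n'] of a point with [x_0 = 1]. *)
Definition slot_var (i : 'I_n) : {mpoly K[q]} :=
  if unlift ord0 i is Some j then 'X_(C (widen_ord rn j)) else 1.

(** Freed slots of index at least [n'] have no coordinate to carry and receive 0. When [r = n] this
    default is itself the hypersurface equation that the dimension count requires. *)
Definition slot_val (L : comNzRingType) (iota : {rmorphism K -> L}) (c : 'I_q -> K)
    (x : 'I_n -> L) (l : 'I_q) : L :=
  if [pick j | C j == l] is Some j then
    if insub (val j) is Some j' then x (lift ord0 j') else 0
  else iota (c l).

Lemma pickC j : [pick j' | C j' == C j] = Some j.
Proof. by case: pickP => [j' /eqP/Ci->|/(_ j)] //; rewrite eqxx. Qed.

Lemma slot_varE (L : comNzRingType) (iota : {rmorphism K -> L}) c x i :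
  x ord0 = 1 -> mmap iota (slot_val iota c x) (slot_var i) = x i.
Proof.
move=> x0; rewrite /slot_var; case: unliftP => [j|] ->; last by rewrite rmorph1.
by rewrite mmapX mmap1U /slot_val pickC /= insubT // => jn; congr (x (lift _ _)); apply: val_inj.
Qed.

(** Where the minor is nonzero, [c] is a rational function, with denominator [\det B], of the [q]
    entries of [slot_val]. The equation [h] confines these entries to a hypersurface, so
    [elimination] yields an equation for [c]. *)
Lemma stratum_locus (h : {mpoly K[q]}) : h != 0 ->
  exists2 g : {mpoly K[q]}, g != 0 &
  forall (L : fieldType) (iota : {rmorphism K -> L}) c x,
  x ord0 = 1 -> orbit_zero iota c x -> \det (mon_mx x R C) != 0 ->
  mmap iota (slot_val iota c x) h = 0 -> g.@[c] = 0.
Proof.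
move=> h0; pose B := mon_mx slot_var R C.
pose rhs i : {mpoly K[q]} :=
  - \sum_(l | l \notin codom C) 'X_l * mmap1 (fun a => slot_var (R i a)) (am l).
pose P l := if [pick j | C j == l] is Some j then \sum_i (\adj B) j i * rhs i
            else 'X_l * \det B.
have [g g0 gP] := elimination P (\det B) h0; exists g => // L iota c x x0 xz dx hz.
set z := slot_val iota c x in hz.
have zB : map_mx (mmap iota z) B = mon_mx x R C.
  rewrite map_mon_mx; apply/matrixP => i j; rewrite !mxE; apply: mmap1_eq => a.
  exact: slot_varE.
have dB : mmap iota z (\det B) = \det (mon_mx x R C) by rewrite -zB det_map_mx.
apply: (gP L iota z c) => //; first by rewrite dB.
move=> l; rewrite /P; case: pickP => [j /eqP<-|nl]; last first.
  by rewrite rmorphM /= mmapX mmap1U /z /slot_val; case: pickP => // j; rewrite nl.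
rewrite dB; pose w : 'cV_r := \col_j iota (c (C j)).
pose b : 'cV_r := \col_i mmap iota z (rhs i).
have Bw : mon_mx x R C *m w = b.
  apply/colP => i; rewrite !mxE /rhs rmorphN rmorph_sum /=.
  have := xz (R i); rewrite (bigID (mem (codom C))) /= => /eqP; rewrite addr_eq0 => /eqP E.
  transitivity (\sum_(l in codom C) iota (c l) * mmap1 (fun a => x (R i a)) (am l)).
    have -> : \sum_(l in codom C) iota (c l) * mmap1 (fun a => x (R i a)) (am l) =
       \sum_(l in [set C j | j in 'I_r]) iota (c l) * mmap1 (fun a => x (R i a)) (am l).
      apply: eq_bigl => l'; apply/codomP/imsetP => [[j' ->]|[j' _ ->]]; last by exists j'.
      by exists j'.
    rewrite big_imset /=; last by move=> ? ? _ _; apply: Ci.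
    by apply: eq_bigr => j' _; rewrite !mxE mulrC.
  rewrite E; congr (- _); apply: eq_bigr => l' l'C; rewrite rmorphM /= mmapX mmap1U.
  congr (_ * _).
    rewrite /z /slot_val; case: pickP => // j' /eqP E'.
    by case/negP: l'C; rewrite -E' codom_f.
  rewrite rmorph_prod /=; apply: eq_bigr => a _; rewrite rmorphXn /=.
  by rewrite slot_varE.
have := congr1 (fun v : 'cV_r => (\adj (mon_mx x R C) *m v) j 0) Bw.
rewrite mulmxA mul_adj_mx mul_scalar_mx mxE [w _ _]mxE mulrC => ->.
rewrite mxE rmorph_sum; apply: eq_bigr => i _.
rewrite rmorphM /= [b _ _]mxE -zB; congr (_ * _).
by rewrite -map_mx_adj mxE.
Qed.
End Slots.
End Stratum.

(** * An [n * n] minor that does not vanish identically *)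

Section SpreadMinor.
Variables (K : fieldType) (n' : nat) (A : seq 'X_{1..n'.+1}).
Local Notation n := n'.+1.
Local Notation q := (size A).
Hypothesis Asym : forall m (s : 'S_n), m \in A -> mperm m s \in A.

Lemma perm_scal (a : 'X_{1..n}) (s : 'S_n) :
  (\sum_i a i * a (s i) <= \sum_i a i ^ 2)%N.
Proof.
have := @leqif_sum _ predT _ _ _ (fun i _ => nat_Cauchy (a i) (a (s i))).
case=> + _; rewrite -big_distrr big_split /=.
have -> : (\sum_i a (s i) ^ 2 = \sum_i a i ^ 2)%N.
  by rewrite [RHS](reindex_inj (@perm_inj _ s)).
by rewrite addnn -mul2n leq_mul2l.
Qed.

Lemma perm_scal_eq (a : 'X_{1..n}) (s : 'S_n) :
  (\sum_i a i * a (s i) = \sum_i a i ^ 2)%N -> forall i, a i = a (s i).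
Proof.
have := @leqif_sum _ predT _ _ _ (fun i _ => nat_Cauchy (a i) (a (s i))).
case=> _; rewrite -big_distrr big_split /=.
have -> : (\sum_i a (s i) ^ 2 = \sum_i a i ^ 2)%N.
  by rewrite [RHS](reindex_inj (@perm_inj _ s)).
rewrite addnn -mul2n eqn_pmul2l // => + E; rewrite E eqxx => /esym/forallP H i.
by have := H i => /eqP.
Qed.

(** After division by ['X^mu] the matrix becomes the identity at [X = 0]. *)
Lemma det_diag_dominant r (e : 'I_r -> 'I_r -> nat) mu :
  (forall i, e i i = mu) -> (forall i j, i != j -> (mu < e i j)%N) ->
  \det (\matrix_(i, j) ('X^(e i j) : {poly K})) != 0.
Proof.
move=> ed eo.
have -> : \matrix_(i, j) ('X^(e i j) : {poly K}) =
    'X^mu *: \matrix_(i, j) 'X^(e i j - mu).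
  apply/matrixP => i j; rewrite !mxE -exprD subnKC //.
  by have [->|/eo/ltnW//] := eqVneq i j; rewrite ed.
rewrite detZ mulf_neq0 // ?expf_neq0 ?polyX_eq0 //.
apply/eqP => /(congr1 (horner_eval 0)); rewrite raddf0 -det_map_mx.
have -> : map_mx (horner_eval 0) (\matrix_(i, j) ('X^(e i j - mu) : {poly K})) = 1%:M.
  apply/matrixP => i j; rewrite !mxE /horner_eval hornerXn.
  have [->|ij] := eqVneq i j; first by rewrite ed subnn.
  by rewrite expr0n subn_eq0 leqNgt eo.
by rewrite det1 => /eqP; rewrite oner_eq0.
Qed.

(** Take [n] distinct rearrangements of [a] and the point with coordinates [X ^ (M - a i)], where
    [M] is the largest entry. The exponent at [(i, j)] is [M * mdeg a] minus the scalar product of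
    the rearrangements [i] and [j], hence strictly smallest on the diagonal by Cauchy-Schwarz.
    Moving the maximum to index 0 makes that coordinate 1, as in the normalised points. *)
Lemma spread_minor a p0 p1 : a \in A -> a p0 != a p1 ->
  exists (R : 'I_n -> 'S_n) (C : 'I_n -> 'I_q) (w : 'I_n -> nat),
  [/\ injective C, w ord0 = 0%N &
   \det (mon_mx (fun i => 'X^(w i) : {poly K}) R C) != 0].
Proof.
wlog [aM [p ap]] : a p0 p1 / (forall i, (a i <= a ord0)%N) /\ exists p, (a p < a ord0)%N.
  move=> W aA a01; pose t0 := [arg max_(i > ord0) a i].
  have t0M i : (a i <= a t0)%N by rewrite /t0; case: arg_maxnP => // t _; apply.
  pose s := tperm ord0 t0.
  apply: (W (mperm a s) (s p0) (s p1)); last 2 first.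
  - exact: Asym.
  - by rewrite !mnmE !tpermK.
  have E0 : mperm a s ord0 = a t0 by rewrite mnmE tpermL.
  split=> [i|]; first by rewrite E0 mnmE.
  exists (if a p0 == a t0 then s p1 else s p0).
  rewrite E0 mnmE ltn_neqAle t0M andbT; case: ifP => [/eqP<-|nE].
    by rewrite tpermK eq_sym.
  by rewrite tpermK nE.
move=> aA _; set M := a ord0 in aM ap.
(* For [a t < M] the value [a t] is exchanged with the maximum at 0; for [a t = M] and [t != ord0]
   the smaller value [a p] is brought to [t]. The position of the displaced maximum distinguishes
   the results. *)
pose R (t : 'I_n) : 'S_n := if a t == M then if t == ord0 then 1%g else tperm t p
                            else tperm ord0 t.
pose b t := mperm a (R t).
have bA t : b t \in A by apply: Asym.
have p0n : ord0 != p by apply: contraTneq ap => <-; rewrite ltnn.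
have b_inj : injective b.
  have bN0 t : a t != M -> b t ord0 = a t.
    by move=> at0; rewrite mnmE /R (negPf at0) tpermL.
  have bM0 t : a t = M -> b t ord0 = M.
    move=> at0; rewrite mnmE /R at0 eqxx; case: eqVneq => [_|t0]; first by rewrite perm1.
    by rewrite tpermD // eq_sym.
  have bNN t u : a t != M -> a u != M -> t != u -> b t <> b u.
    move=> at0 au0 tu /mnmP/(_ t); rewrite !mnmE /R (negPf at0) (negPf au0) tpermR tpermD.
    - by move/esym/eqP; rewrite (negPf at0).
    - by apply: contraNneq at0 => <-.
    by rewrite eq_sym.
  have bMM t u : a t = M -> a u = M -> t != ord0 -> t != u -> b t <> b u.
    move=> at0 au0 t0 tu /mnmP/(_ t); rewrite !mnmE /R at0 au0 eqxx (negPf t0) tpermL.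
    move=> E; have := ap; rewrite E; case: eqVneq => [_|u0]; first by rewrite perm1 at0 ltnn.
    rewrite tpermD ?at0 ?ltnn // 1?eq_sym //.
    by apply: contraTneq ap => <-; rewrite at0 ltnn.
  move=> t u E; apply/eqP/negPn/negP => tu.
  have E0 : b t ord0 = b u ord0 by rewrite E.
  have [at0|at0] := eqVneq (a t) M; have [au0|au0] := eqVneq (a u) M.
  - have [t0|t0] := eqVneq t ord0; last exact: (bMM t u).
    by apply: (bMM u t) => //; rewrite -?t0 eq_sym.
  - by have := bN0 _ au0; rewrite -E0 bM0 // => /esym/eqP; rewrite (negPf au0).
  - by have := bN0 _ at0; rewrite E0 bM0 // => /esym/eqP; rewrite (negPf at0).
  exact: (bNN t u).
have bq t : (index (b t) A < q)%N by rewrite index_mem.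
exists R, (fun t => Ordinal (bq t)), (fun i => M - a i)%N; split.
- move=> t u /(congr1 (fun l : 'I_q => nth 0%MM A l)) /=.
  by rewrite !nth_index // => /b_inj.
- by rewrite subnn.
pose e i j := (\sum_t (M - a (R i t)) * a (R j t))%N.
have -> : mon_mx (fun i => 'X^(M - a i) : {poly K}) R (fun t => Ordinal (bq t)) =
    \matrix_(i, j) 'X^(e i j).
  apply/matrixP => i j; rewrite !mxE /= nth_index // /mmap1 /e.
  rewrite (big_morph (fun k => 'X^k : {poly K}) (exprD _) (expr0 _)).
  by apply: eq_bigr => t _; rewrite mnmE -exprM.
pose sc i j := (\sum_t a t * a (((R i)^-1 * R j)%g t))%N.
have esc i j : (e i j + sc i j = M * mdeg a)%N.
  have -> : sc i j = (\sum_t a (R i t) * a (R j t))%N.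
    rewrite /sc (reindex_inj (@perm_inj _ (R i))); apply: eq_bigr => t _.
    by rewrite permM permK.
  rewrite /e -big_split /= mdegE [in RHS](reindex_inj (@perm_inj _ (R j))) big_distrr /=.
  by apply: eq_bigr => t _; rewrite -mulnDl subnK.
have scd i : sc i i = (\sum_t a t ^ 2)%N.
  by apply: eq_bigr => t _; rewrite mulVg perm1.
apply: (@det_diag_dominant _ _ (M * mdeg a - \sum_t a t ^ 2)%N) => [i|i j ij].
  by rewrite -(scd i) -(esc i i) addnK.
have : (sc i j < \sum_t a t ^ 2)%N.
  rewrite ltn_neqAle perm_scal andbT; apply: contraNneq ij => /perm_scal_eq H.
  apply/eqP/b_inj/mnmP => t; rewrite !mnmE.
  by rewrite (H (R i t)) permM permK.
by have := esc i j; have := esc i i; rewrite scd; lia.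
Qed.
End SpreadMinor.

(** * The rank of the orbit system at a point *)

Lemma mmap1_mperm (S : comNzRingType) n (x : 'I_n -> S) (b : 'X_{1..n}) (s : 'S_n) :
  mmap1 x (mperm b s) = mmap1 (fun i => x (s^-1%g i)) b.
Proof.
rewrite /mmap1 (reindex_inj (@perm_inj _ s^-1%g)); apply: eq_bigr => i _.
by rewrite mnmE permKV.
Qed.

Section OrbitRank.
Variables (L : fieldType) (n : nat) (A : seq 'X_{1..n}).
Local Notation q := (size A).
Local Notation am l := (nth 0%MM A l).
Hypothesis L0 : [pchar L] =i pred0.
Hypothesis Asym : forall m (s : 'S_n), m \in A -> mperm m s \in A.
Hypothesis Auniq : uniq A.
Implicit Types (x y : 'I_n -> L) (s : 'S_n).

Definition perm_op s : 'M[L]_q := \matrix_(l', l) (am l' == mperm (am l) s)%:R.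

Definition mon_row x : 'rV[L]_q := \row_l mmap1 x (am l).

(** Its row space is the space [V_x] of equations on the coefficients. *)
Definition orbit_mx x : 'M[L]_(#|'S_n|, q) :=
  \matrix_(i < #|'S_n|) mon_row (fun a => x (enum_val i a)).

Lemma sum_perm_op (F : 'X_{1..n} -> L) (l : 'I_q) s :
  \sum_(l' < q) F (am l') * perm_op s l' l = F (mperm (am l) s).
Proof.
have bA : mperm (am l) s \in A by apply: Asym; rewrite mem_nth.
have lq : (index (mperm (am l) s) A < q)%N by rewrite index_mem.
rewrite (bigD1 (Ordinal lq)) //= mxE /= nth_index // eqxx mulr1 big1 ?addr0 // => l' l'l.
rewrite mxE; case: eqP => [E|]; last by rewrite mulr0.
case/eqP: l'l; apply: val_inj => /=.
by rewrite -E index_uniq.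
Qed.

Lemma mon_row_perm x s : mon_row x *m perm_op s = mon_row (fun i => x (s^-1%g i)).
Proof.
apply/rowP => l; rewrite !mxE -mmap1_mperm -(sum_perm_op (mmap1 x)).
by apply: eq_bigr => l' _; rewrite mxE.
Qed.

Lemma perm_opM s s' : perm_op s *m perm_op s' = perm_op (s * s')%g.
Proof.
apply/matrixP => l' l; rewrite mxE.
rewrite (eq_bigr (fun k : 'I_q => (am l' == mperm (am k) s)%:R * perm_op s' k l)); last first.
  by move=> k _; rewrite mxE.
rewrite (sum_perm_op (fun b => (am l' == mperm b s)%:R)) mxE.
by congr ((_ == _)%:R); apply/mnmP => i; rewrite !mnmE permM.
Qed.

Lemma perm_op1 : perm_op 1%g = 1%:M.
Proof.
apply/matrixP => l' l; rewrite !mxE.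
have -> : mperm (am l) 1%g = am l by apply/mnmP => i; rewrite mnmE perm1.
by rewrite nth_uniq.
Qed.

Lemma perm_op_transp : transp_rel (fun i j => perm_op (tperm i j)).
Proof.
split=> [i j|i j ij|i j k l ij kl]; first by rewrite tpermC.
  by rewrite perm_opM tperm2 perm_op1.
by rewrite !perm_opM -tpermJ conjgE tpermV mulgA.
Qed.

Lemma orbit_mx_stable x : stableT (fun i j => perm_op (tperm i j)) setT (orbit_mx x).
Proof.
move=> i j _ _ ij; apply/row_subP => k; rewrite row_mul rowK mon_row_perm.
pose s : 'S_n := ((tperm i j)^-1 * enum_val k)%g.
have -> : mon_row (fun a => x (enum_val k ((tperm i j)^-1%g a))) = row (enum_rank s) (orbit_mx x).
  by rewrite rowK enum_rankK; apply/rowP => l; rewrite !mxE; apply: mmap1_eq => a; rewrite permM.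
exact: row_sub.
Qed.

(** The row of the identity permutation is moved by [(i j)(k l)], as its entry at [b] shows, so the
    bound for nontrivial representations applies to the row space. *)
Lemma orbit_rank x b i j k l : b \in A ->
  i != j -> k != l -> i != k -> i != l -> j != k -> j != l ->
  mmap1 (fun a => x (tperm i j (tperm k l a))) b != mmap1 x b ->
  (n.-1 <= \rank (orbit_mx x))%N.
Proof.
move=> bA ij kl ik il jk jl nb.
have := @transp_rank_ge _ _ _ _ setT _ (orbit_mx x) i j k l L0 perm_op_transp.
rewrite cardsT card_ord; apply; rewrite ?inE //; first exact: orbit_mx_stable.
apply: contra_neq nb => E.
have := congr1 (row (enum_rank 1%g)) E; rewrite !row_mul rowK enum_rankK.
rewrite !mon_row_perm => /rowP; have lq : (index b A < q)%N by rewrite index_mem.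
move/(_ (Ordinal lq)); rewrite !mxE /= nth_index // => E'.
have -> : mmap1 x b = mmap1 (fun a => x ((1%g : 'S_n) a)) b.
  by apply: mmap1_eq => a; rewrite perm1.
by rewrite -E'; apply: mmap1_eq => a; rewrite !tpermV perm1.
Qed.

Hypothesis n5 : (4 < n)%N.

Lemma two_others (i j : 'I_n) : exists k l : 'I_n,
  [/\ k != l, i != k, i != l, j != k & j != l].
Proof.
have [|k [l [[_ _ kl] /andP[]]]] := @two_outside _ [set: 'I_n] [:: i; j].
  by rewrite cardsT card_ord /=; lia.
rewrite !inE !negb_or => /andP[ki kj] /andP[li lj]; exists k, l.
by split=> //; rewrite eq_sym.
Qed.

(** Exchanging the zero coordinate with one that occurs in [b] makes the monomial vanish; a disjoint
    [(k l)] restores evenness without interfering. *)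
Lemma orbit_rank_zero x b z : b \in A -> b != 0%MM -> x z = 0 -> mmap1 x b != 0 ->
  (n.-1 <= \rank (orbit_mx x))%N.
Proof.
move=> bA b0 xz xb.
have [i bi] : exists i, b i != 0%N.
  apply/existsP; apply: contraNT b0 => /existsPn H.
  by apply/eqP/mnmP => i; rewrite mnm0E; apply/eqP/negPn.
have iz : i != z.
  apply: contraNneq xb => iz; rewrite /mmap1 (bigD1 i) //= iz xz -iz expr0n.
  by rewrite (negPf bi) mul0r.
have [k [l [kl ik il zk zl]]] := two_others i z.
apply: (@orbit_rank x b i z k l) => //.
have kli : tperm k l i = i by rewrite tpermD // eq_sym.
rewrite [X in X != _]/mmap1 (bigD1 i) //= kli tpermL xz expr0n.
by rewrite (negPf bi) mul0r eq_sym.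
Qed.

Lemma mmap1_tperm x b i j : i != j ->
  mmap1 (fun a => x (tperm i j a)) b * (x i ^+ b i * x j ^+ b j) =
  mmap1 x b * (x j ^+ b i * x i ^+ b j).
Proof.
move=> ij; have split2 y : mmap1 y b =
    y i ^+ b i * (y j ^+ b j * \prod_(a | (a != i) && (a != j)) y a ^+ b a).
  by rewrite /mmap1 (bigD1 i) //= (bigD1 j) // eq_sym.
rewrite !split2 tpermL tpermR (eq_bigr (fun a => x a ^+ b a)); first by ring.
by move=> a /andP[ai aj]; rewrite tpermD // eq_sym.
Qed.

(** Suppose the rank is smaller, so that double transpositions preserve all monomial values, and
    rearrange [a] to [b] with [b i = a p] and [b j = a p']. Then [(i j)] and [(k l)] send [m0] to
    the same value [m2]. Applying [(i j)] before and after [(k l)] gives [m2 * E = m0 * E'] and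
    [m0 * E = m2 * E'], hence [E ^+ 2 = E' ^+ 2]; this is the origin of the factor 2 in the
    exponent. *)
Lemma orbit_rank_nonzero x a p p' i j : a \in A -> (a p' < a p)%N ->
  (forall i, x i != 0) -> x i ^+ (2 * (a p - a p')) != x j ^+ (2 * (a p - a p')) ->
  (n.-1 <= \rank (orbit_mx x))%N.
Proof.
move=> aA ap xn0 xij.
have ij : i != j by apply: contraNneq xij => ->.
have pp : p != p' by apply: contraTneq ap => ->; rewrite ltnn.
have [k [l [kl ik il jk jl]]] := two_others i j.
pose s : 'S_n := (tperm i p * tperm (tperm i p j) p')%g.
have jp : tperm i p j != p.
  by rewrite -[X in _ != X](tpermL i p) (inj_eq perm_inj) eq_sym.
have si : s i = p by rewrite permM tpermL (tpermD jp) // eq_sym.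
have sj : s j = p' by rewrite permM tpermL.
pose b := mperm a s; pose b' := mperm b (tperm i j).
have bA : b \in A by apply: Asym.
have b'A : b' \in A by apply: Asym.
rewrite leqNgt; apply/negP => rk.
have inv c : c \in A -> mmap1 (fun a => x (tperm i j (tperm k l a))) c = mmap1 x c.
  move=> cA; apply/eqP/negPn/negP => /(orbit_rank cA ij kl ik il jk jl).
  by rewrite leqNgt rk.
have com u : tperm i j (tperm k l u) = tperm k l (tperm i j u).
  have ck : tperm i j k = k by rewrite tpermD.
  have cl : tperm i j l = l by rewrite tpermD.
  by rewrite -[LHS]permJ tpermJ ck cl.
set m0 := mmap1 x b; pose m2 := mmap1 (fun u => x (tperm i j u)) b.
have m00 : m0 != 0 by apply/prodf_neq0 => u _; apply: expf_neq0.
have xb' : mmap1 x b' = m2.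
  by rewrite mmap1_mperm; apply: mmap1_eq => u; rewrite tpermV.
have m2E : mmap1 (fun u => x (tperm k l u)) b = m2.
  rewrite -xb' -(inv b') // (mmap1_mperm _ b (tperm i j)); apply: mmap1_eq => u.
  by rewrite tpermV com tpermK.
have E1 : m2 * (x i ^+ b i * x j ^+ b j) = m0 * (x j ^+ b i * x i ^+ b j).
  exact: mmap1_tperm.
have E2 : m0 * (x i ^+ b i * x j ^+ b j) = m2 * (x j ^+ b i * x i ^+ b j).
  have := mmap1_tperm (fun u => x (tperm k l u)) b ij.
  have kli : tperm k l i = i by rewrite tpermD // eq_sym.
  have klj : tperm k l j = j by rewrite tpermD // eq_sym.
  rewrite kli klj m2E => <-; congr (_ * _).
  by rewrite /m0 -(inv b) //; apply: mmap1_eq => u; rewrite com.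
have bi : b i = a p by rewrite mnmE si.
have bj : b j = a p' by rewrite mnmE sj.
pose E := x i ^+ a p * x j ^+ a p'; pose E' := x j ^+ a p * x i ^+ a p'.
rewrite bi bj -/E -/E' in E1 E2.
have EE : E ^+ 2 = E' ^+ 2.
  by apply: (mulfI m00); rewrite !expr2 [LHS]mulrA E2 [LHS]mulrAC E1 -[LHS]mulrA.
case/eqP: xij; apply: (@mulfI _ ((x i * x j) ^+ (2 * a p'))).
  by rewrite expf_neq0 // mulf_neq0.
move: EE; rewrite /E /E' !(mulnC 2%N) !exprM -{1 2}(subnK (ltnW ap)) !exprD !exprMn => EE.
by apply: etrans (etrans EE _); ring.
Qed.
End OrbitRank.

(** * Points from prime ideals *)

Section PrimeIdeal.
Variables (R : comNzRingType) (J : R -> Prop) (p : R).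

Definition is_ideal (I : R -> Prop) :=
  [/\ I 0, forall a b, I a -> I b -> I (a + b) & forall a b, I b -> I (a * b)].

Hypotheses (idJ : is_ideal J) (pJ : forall e, ~ J (p ^+ e)).

Lemma maximal_avoiding : exists I : R -> Prop,
  [/\ is_ideal I, forall a, J a -> I a, forall e, ~ I (p ^+ e) &
   forall I', is_ideal I' -> (forall a, I a -> I' a) ->
     (forall e, ~ I' (p ^+ e)) -> forall a, I' a -> I a].
Proof.
pose good (I : R -> Prop) :=
  [/\ is_ideal I, forall a, J a -> I a & forall e, ~ I (p ^+ e)].
pose P (I : R -> Prop) := (forall a, ~ I a) \/ good I.
have goodP I a : P I -> I a -> good I by case=> // /(_ a).
have [F FP totF|I [PI maxI]] := @classical_sets.Zorn_bigcup R P.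
  have [[I [FI [x Ix]]]|noI] := boolp.pselect (exists I, F I /\ exists x, I x); last first.
    by left=> a [I FI Ia]; apply: noI; exists I; split; last exists a.
  have gI := goodP _ _ (FP _ FI) Ix.
  right; split=> [|a Ja|e [I' FI' Ie]].
  - split=> [|a b [A FA Aa] [B FB Bb]|a b [B FB Bb]].
    + by exists I => //; case: gI => [[]].
    + have [gA gB] := (goodP _ _ (FP _ FA) Aa, goodP _ _ (FP _ FB) Bb).
      have [AB|BA] := totF _ _ FA FB.
        by exists B => //; case: gB => [[_ + _] _ _]; apply => //; apply: AB.
      by exists A => //; case: gA => [[_ + _] _ _]; apply => //; apply: BA.
    by exists B => //; case: (goodP _ _ (FP _ FB) Bb) => [[_ _ +] _ _]; apply.
  - by exists I => //; case: gI => _ + _; apply.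
  by case: (goodP _ _ (FP _ FI') Ie) => _ _ /(_ e).
have gJ : good J by [].
have gI : good I.
  case: PI => // nI; case: (maxI J); last by right.
  by split=> [a /nI//|JI]; case: idJ => /JI/nI.
exists I; case: gI => idI JI pI; split=> // I' idI' II' pI' a I'a.
apply: boolp.contrapT => nIa; apply: (maxI I'); first by split=> // /(_ a I'a).
by right; split=> // b /JI/II'.
Qed.

(** An ideal maximal among those avoiding the powers of [p] is prime: if [a] and [b] are outside it,
    [I + (a)] and [I + (b)] each contain a power of [p], and the product of these powers lies in
    [I + (a * b)]. *)
Lemma prime_avoiding : exists I : R -> Prop,
  [/\ is_ideal I, forall a, J a -> I a, ~ I 1, ~ I p &
   forall a b, I (a * b) -> I a \/ I b].
Proof.
have [I [idI JI pI maxI]] := maximal_avoiding.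
have [I0 ID IM] := idI.
exists I; split=> //; [exact: (pI 0%N) | exact: (pI 1%N) |].
have pw a : ~ I a -> exists e r, I (p ^+ e - r * a).
  move=> nIa; apply: boolp.contrapT => nE.
  pose I' b := exists r, I (b - r * a).
  apply: nIa; apply: (maxI I'); last by exists 1; rewrite mul1r subrr.
  - split; first by exists 0; rewrite mul0r subr0.
      move=> b c [r Ir] [s Is]; exists (r + s).
      by rewrite mulrDl opprD addrACA; apply: ID.
    by move=> b c [r Ir]; exists (b * r); rewrite -mulrA -mulrBr; apply: IM.
  - by move=> b Ib; exists 0; rewrite mul0r subr0.
  by move=> e [r Ir]; apply: nE; exists e, r.
move=> a b Iab; have [Ia|nIa] := boolp.pselect (I a); first by left.
right; apply: boolp.contrapT => nIb.
have [e [r Ir]] := pw _ nIa; have [f [s Is]] := pw _ nIb.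
apply: (pI (e + f)%N); rewrite exprD.
have -> : p ^+ e * p ^+ f = p ^+ f * (p ^+ e - r * a) + (r * a * (p ^+ f - s * b) + r * s * (a * b)).
  by ring.
by apply: (ID); [apply: IM | apply: ID; apply: IM].
Qed.
End PrimeIdeal.

(** Units and inverses are chosen classically, which gives [D] the structure over which its field of
    fractions is formed. *)
Lemma domain_in_field (D : comNzRingType) :
  (forall x y : D, x * y = 0 -> (x == 0) || (y == 0)) ->
  exists (L : fieldType) (phi : {rmorphism D -> L}), injective phi.
Proof.
move=> intD.
pose un : pred D := fun x => boolp.asbool (exists y, y * x = 1).
pose inv (x : D) := if boolp.pselect (exists y, y * x = 1) is left ex
  then projT1 (boolp.cid ex) else x.
have mulV : {in un, left_inverse 1 inv *%R}.
  move=> x /boolp.asboolP ex; rewrite /inv; case: boolp.pselect => // ex'.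
  exact: (projT2 (boolp.cid ex')).
have unP x y : y * x = 1 -> un x by move=> E; apply/boolp.asboolP; exists y.
have invN : {in [predC un], inv =1 id}.
  move=> x; rewrite inE => /boolp.asboolP nex.
  by rewrite /inv; case: boolp.pselect.
pose m1 := GRing.ComNzRing_hasMulInverse.Build D mulV unP invN.
pose D1 := HB.pack_for comUnitRingType D m1.
pose m2 := GRing.ComUnitRing_isIntegral.Build D1 intD.
pose D2 := HB.pack_for idomainType D1 m2.
exists {fraction D2}, (@FracField.tofrac D2 : {rmorphism D2 -> {fraction D2}}).
by move=> x y /eqP; rewrite tofrac_eq => /eqP.
Qed.

Lemma prime_point (R : comNzRingType) (I : R -> Prop) : is_ideal I -> ~ I 1 ->
  (forall a b, I (a * b) -> I a \/ I b) ->
  exists (L : fieldType) (phi : {rmorphism R -> L}), forall a, I a <-> phi a = 0.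
Proof.
move=> [I0 ID IM] I1 Ip.
pose S : {pred R} := fun a => boolp.asbool (I a).
have SP a : reflect (I a) (a \in S) by apply: (iffP idP) => /boolp.asboolP.
have idS : idealr_closed S.
  split; first exact/SP; first by apply/negP => /SP.
  by move=> a u v /SP Iu /SP Iv; apply/SP/ID => //; apply: IM.
have prS : prime_idealr_closed S.
  by move=> a b /SP/Ip[] ?; apply/orP; [left | right]; apply/SP.
pose m1 := isIdealr.Build R S idS.
pose m2 := isPrimeIdealrClosed.Build R S prS.
pose Q := HB.pack_for (PrimeIdealr.type R) S m1 m2.
have [L [phi phi_inj]] := @domain_in_field {ideal_quot Q} (@Quotient.rquot_IdomainAxiom R Q).
pose pr : {rmorphism R -> {ideal_quot Q}} := (\pi_({ideal_quot Q}))%qT.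
have prE a : (pr a == 0) = (a \in S).
  by rewrite -[a in RHS]subr0 -[S in RHS]/(Q : pred R) Quotient.idealrBE -(rmorph0 pr).
exists L, (phi \o pr) => a /=.
split=> [Ia|/eqP].
  suff /eqP-> : pr a == 0 by rewrite rmorph0.
  by rewrite prE; apply/SP.
by rewrite -(rmorph0 phi) => /eqP/phi_inj/eqP; rewrite prE => /SP.
Qed.

(** The point is the generic point of a prime containing [G] but not [p]: its coordinates are the
    classes of the variables in the residue field. *)
Lemma radical_point (K : fieldType) n (G : {mpoly K[n]} -> Prop) (p : {mpoly K[n]}) :
  ~ in_radical G p -> exists (L : fieldType) (iota : {rmorphism K -> L}) (x : 'I_n -> L),
  (forall g, G g -> mmap iota x g = 0) /\ mmap iota x p != 0.
Proof.
move=> np.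
have idG : is_ideal (in_ideal G).
  split.
  - by exists 0%N, (fun=> 0), (fun=> 0); split=> [[]//|]; rewrite big_ord0.
  - move=> a b [r [g [c [Gg ->]]]] [s [g' [c' [Gg' ->]]]].
    exists (r + s)%N, (fun i => match split i with inl j => g j | inr j => g' j end),
      (fun i => match split i with inl j => c j | inr j => c' j end).
    split=> [i|]; first by case: split.
    rewrite big_split_ord; congr (_ + _); apply: eq_bigr => i _ /=.
      case: splitP => [j ij|j /= ij]; first by have -> : i = j by apply/val_inj.
      by have := ltn_ord i; rewrite ij ltnNge leq_addr.
    case: splitP => [j /= ij|j /= /addnI ij]; last by have -> : i = j by apply/val_inj.
    by have := ltn_ord j; rewrite -ij ltnNge leq_addr.
  move=> a b [r [g [c [Gg ->]]]]; exists r, g, (fun i => a * c i); split=> //.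
  by rewrite mulr_sumr; apply: eq_bigr => i _; rewrite mulrA.
have pG e : ~ in_ideal G (p ^+ e) by move=> pe; apply: np; exists e.
have [I [idI GI I1 Ip prI]] := prime_avoiding idG pG.
have [L [phi phiP]] := prime_point idI I1 prI.
pose iota := (phi \o (@mpolyC n K : {rmorphism K -> {mpoly K[n]}}) : {rmorphism K -> L}).
pose x (i : 'I_n) := phi 'X_i.
have E q : mmap iota x q = phi q.
  rewrite [q in RHS]mpolyE rmorph_sum; apply: eq_bigr => m _.
  rewrite -mul_mpolyC rmorphM /=; congr (_ * _).
  by rewrite mpolyXE_id rmorph_prod; apply: eq_bigr => i _; rewrite rmorphXn.
exists L, iota, x; split=> [g Gg|]; rewrite E; last by apply/eqP => /phiP.
apply/phiP/GI; exists 1%N, (fun=> g), (fun=> 1); split=> //.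
by rewrite big_ord1 mul1r.
Qed.

(** * General coefficients *)

Lemma mmap1_scale (S : comNzRingType) n (x : 'I_n -> S) a (b : 'X_{1..n}) :
  mmap1 (fun i => a * x i) b = a ^+ mdeg b * mmap1 x b.
Proof.
rewrite /mmap1 mdegE expr_sum -big_split; apply: eq_bigr => i _ /=.
exact: exprMn.
Qed.

Lemma mmap1_eq0 (S : comNzRingType) n (x : 'I_n -> S) (b : 'X_{1..n}) :
  (#|[pred i | x i != 0%R]| < npos b)%N -> mmap1 x b = 0.
Proof.
move=> xb; have : ~~ ([pred i | (0 < b i)%N] \subset [pred i | x i != 0]).
  by apply: contraTN xb => /subset_leq_card; rewrite -leqNgt.
case/subsetPn=> i; rewrite !inE => bi /negPn/eqP xi.
by rewrite /mmap1 (bigD1 i) //= xi expr0n; case: (b i) bi => // j _; rewrite mul0r.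
Qed.

Lemma npos_mperm n (b : 'X_{1..n}) (s : 'S_n) : npos (mperm b s) = npos b.
Proof.
rewrite /npos -!sum1_card (reindex_inj (@perm_inj _ s^-1%g)).
by apply: eq_bigl => i; rewrite !inE mnmE permKV.
Qed.

Lemma support_fit (S : idomainType) n (A : seq 'X_{1..n}) (x : 'I_n -> S) a :
  (forall m (s : 'S_n), m \in A -> mperm m s \in A) -> a \in A ->
  (npos a <= #|[pred i | x i != 0%R]|)%N -> exists2 b, b \in A & mmap1 x b != 0.
Proof.
move=> Asym; pose S2 := [set i | x i != 0].
pose S1 (a : 'X_{1..n}) := [set i | (0 < a i)%N].
have [N] := ubnP #|S1 a :\: S2|; elim: N => // N IH in a * => aN aA ax.
have [S0|] := set_0Vmem (S1 a :\: S2).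
  exists a => //; apply/prodf_neq0 => i _; have [->|bi] := posnP (a i).
    by rewrite expr0 oner_neq0.
  apply: expf_neq0; have := in_set0 i; rewrite -S0 !inE bi andbT.
  by move/negbFE.
case=> i; rewrite !inE => /andP[xi ai].
have [S0|] := set_0Vmem (S2 :\: S1 a).
  have : (#|S2| < #|S1 a|)%N.
    apply/proper_card/properP; split; last by exists i; rewrite inE.
    by rewrite -setD_eq0 S0.
  by rewrite ltnNge !cardsE ax.
case=> j; rewrite !inE => /andP[aj xj].
have ij : i != j by apply: contraNneq aj => <-.
apply: (IH (mperm a (tperm i j))); rewrite ?npos_mperm ?Asym //.
apply: leq_trans (_ : #|S1 a :\: S2| <= N)%N => //; apply/proper_card/properP; split.
  apply/subsetP => u; rewrite !inE mnmE => /andP[xu]; rewrite xu /=.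
  have [<-|iu] := eqVneq i u; first by rewrite ai.
  have [ju|ju] := eqVneq j u; first by rewrite -ju xj in xu.
  by rewrite tpermD.
by exists i; rewrite !inE ?mnmE ?tpermL ?(negPf aj) ?andbF ?xi.
Qed.

(** * A hypersurface containing all exceptional coefficient vectors *)

Section GenericLocus.
Variables (K : fieldType) (n' : nat) (A : seq 'X_{1..n'.+1}) (d : nat).
Local Notation n := n'.+1.
Local Notation q := (size A).
Hypothesis K0 : [pchar K] =i pred0.
Hypothesis n5 : (4 < n)%N.
Hypothesis Auniq : uniq A.
Hypothesis Ahom : forall m, m \in A -> mdeg m = d.
Hypothesis Asym : forall m (s : 'S_n), m \in A -> mperm m s \in A.

(** A nonvanishing monomial of [A] stands in for the number of nonzero coordinates of [x];
    [support_fit] passes from the latter to the former. *)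
Definition excludes (g : {mpoly K[q]}) :=
  forall (L : fieldType) (iota : {rmorphism K -> L}) c (x : 'I_n -> L),
  orbit_zero iota c x -> (exists2 b, b \in A & mmap1 x b != 0) -> g.@[c] = 0.

(** Homogeneity leaves room for only one constant exponent vector, so [f] is a single term and its
    coefficient serves as [g]. *)
Lemma constant_locus : A != [::] ->
  (forall a p p', a \in A -> a p = a p') -> exists2 g, g != 0 & excludes g.
Proof.
move=> A0 Ac; have q0 : (0 < q)%N by rewrite lt0n size_eq0.
pose l0 := Ordinal q0.
have A1 b : b \in A -> b = nth 0%MM A l0.
  move=> bA; have aA : nth 0%MM A l0 \in A by rewrite mem_nth.
  apply/mnmP => i; rewrite (Ac b i ord0) // (Ac (nth _ _ _) i ord0) //.
  have cst m : m \in A -> (mdeg m = n * m ord0)%N.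
    move=> mA; rewrite mdegE (eq_bigr (fun=> m ord0)) ?sum_nat_const ?card_ord //.
    by move=> j _; apply: Ac.
  by have /eqP := Ahom aA; rewrite -(Ahom bA) !cst // eqn_pmul2l // => /eqP.
exists 'X_l0.
  by apply/eqP => /(congr1 (mcoeff U_(l0))) /eqP; rewrite mcoeffX mcoeff0 eqxx oner_eq0.
move=> L iota c x xz [b bA xb]; rewrite mevalXU; apply/eqP; rewrite -(fmorph_eq0 iota).
have := xz 1%g; rewrite (bigD1 l0) //= big1 => [|l ll0]; last first.
  case/eqP: ll0; apply: val_inj => /=.
  have lA : nth 0%MM A l \in A by rewrite mem_nth.
  by apply/eqP; rewrite -(nth_uniq 0%MM (ltn_ord l) q0 Auniq) (A1 _ lA).
rewrite addr0 (mmap1_eq (f2 := x)); last by move=> i; rewrite perm1.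
by move/eqP; rewrite mulf_eq0 -/(val l0) -(A1 b) // (negPf xb) orbF.
Qed.

(** Three kinds of points are covered: [g1] those where the spread minor is nonzero, [g2] those
    where it vanishes but some minor of size [n - 1] does not, and [g3] those whose normalised
    coordinates are roots of unity of bounded order. *)
Lemma nonconstant_locus a p p' : a \in A -> (a p' < a p)%N ->
  exists2 g, g != 0 & excludes g.
Proof.
move=> aA ap; have pp : a p != a p' by rewrite neq_ltn ap orbT.
have [R2 [C2 [w [C2i w0 dX]]]] := spread_minor K Asym aA pp.
have mX (l : 'I_q) : ('X_l : {mpoly K[q]}) != 0.
  by apply/eqP => /(congr1 (mcoeff U_(l))) /eqP; rewrite mcoeffX mcoeff0 eqxx oner_eq0.
(* With [n] freed slots for [n'] coordinates, the last slot holds 0, so its variable is the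
   hypersurface equation. *)
have [g1 g10 g1P] := stratum_locus R2 (leqnSn n') C2i (mX (C2 ord_max)).
pose idx := ({ffun 'I_n' -> 'S_n} * {ffun 'I_n' -> 'I_q})%type.
have /fin_all_exists2[g2 g20 g2P] (RC : idx) : exists2 g : {mpoly K[q]}, g != 0 &
    injective RC.2 -> forall (L : fieldType) (iota : {rmorphism K -> L}) c x,
    x ord0 = 1 -> orbit_zero iota c x -> \det (mon_mx x RC.1 RC.2) != 0 ->
    \det (mon_mx x R2 C2) = 0 -> g.@[c] = 0.
  have [Ci|nCi] := boolP (injectiveb RC.2); last first.
    by exists 1; [exact: oner_neq0 | move/injectiveP; rewrite (negPf nCi)].
  move/injectiveP: Ci => Ci.
  pose h := \det (mon_mx (slot_var K RC.2 (leqnn n')) R2 C2).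
  have hE (S : comNzRingType) (iota : {rmorphism K -> S}) c x : x ord0 = 1 ->
      mmap iota (slot_val RC.2 iota c x) h = \det (mon_mx x R2 C2).
    move=> x0; rewrite /h -det_map_mx map_mon_mx; congr (\det _).
    by apply/matrixP => i j; rewrite !mxE; apply: mmap1_eq => u; apply: slot_varE.
  have h0 : h != 0.
    (* Substituting the monomial curve for the slot variables turns [h] into the spread minor, which
       is nonzero. *)
    apply: contra_neq dX => h0; rewrite -(hE _ (@polyC K : {rmorphism K -> {poly K}}) (fun=> 0)).
      by rewrite h0 raddf0.
    by rewrite w0.
  have [g g0 gP] := stratum_locus RC.1 (leqnn n') Ci h0; exists g => // _.
  move=> L iota c x x0 xz dx d2; apply: (gP L iota c x) => //.
  by rewrite hE.
pose M := (2 * (a p - a p')).-1.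
have ME : M.+1 = (2 * (a p - a p'))%N by rewrite prednK // muln_gt0 /= subn_gt0.
have A0 : A != [::] by apply: contraTneq aA => ->.
have [g3 g30 g3P] := root_of_unity_locus K M A0.
exists (g1 * g3 * \prod_RC g2 RC).
  by rewrite !mulf_neq0 //; apply/prodf_neq0 => RC _; apply: g20.
move=> L iota c x xz [b bA xb]; rewrite !mevalM rmorph_prod /=.
have L0 : [pchar L] =i pred0 by move=> u; rewrite (fmorph_pchar iota) K0.
have d0 : (0 < d)%N.
  by rewrite -(Ahom aA) mdegE (bigD1 p) //= addn_gt0 (leq_ltn_trans _ ap).
have b0 : b != 0%MM by rewrite -mdeg_eq0 (Ahom bA) -lt0n.
have [i xi] : exists i, x i != 0.
  apply/existsP; apply: contraNT xb => /existsPn x0.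
  rewrite mmap1_eq0 // eq_card0 ?lt0n; last by move=> i; rewrite !inE (negPf (x0 i)).
  apply: contraNneq b0 => /card0_eq nb; apply/eqP/mnmP => i.
  by have := nb i; rewrite !inE mnm0E lt0n => /negbFE/eqP.
(* Homogeneity and symmetry of [A] allow a nonzero coordinate of [x] to be moved to index 0 and
   scaled to 1. *)
pose s : 'S_n := tperm ord0 i; pose y u := (x i)^-1 * x (s u).
have y0 : y ord0 = 1 by rewrite /y tpermL mulVf.
have yz : orbit_zero iota c y.
  move=> u; transitivity ((x i)^-1 ^+ d * \sum_(l < q) iota (c l) *
      mmap1 (fun i => x ((u * s)%g i)) (nth 0%MM A l)); last by rewrite xz mulr0.
  rewrite mulr_sumr; apply: eq_bigr => l _; rewrite /y mmap1_scale Ahom ?mem_nth // mulrCA.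
  by congr (_ * (_ * _)); apply: mmap1_eq => v; rewrite permM.
pose b' := mperm b s; have b'A : b' \in A by apply: Asym.
have yb' : mmap1 y b' != 0.
  rewrite /y mmap1_scale mulf_neq0 ?expf_neq0 ?invr_neq0 // mmap1_mperm.
  by rewrite (mmap1_eq (f2 := x)) // => v; rewrite permKV.
have b'0 : b' != 0%MM by rewrite -mdeg_eq0 (Ahom b'A) -lt0n.
have [/forallP yM|] := boolP [forall v, y v ^+ M.+1 == 1].
  rewrite (g3P L iota c y) ?mulr0 ?mul0r // => [v|]; first exact/eqP/yM.
  rewrite -[RHS](yz 1%g); apply: eq_bigr => l _; congr (_ * _).
  by apply: mmap1_eq => v; rewrite perm1.
rewrite negb_forall => /existsP[v yv].
have rk : (n' <= \rank (orbit_mx A y))%N.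
  have [/existsP[z /eqP yz0]|/existsPn yn0] := boolP [exists z, y z == 0].
    exact: (orbit_rank_zero L0 Asym Auniq n5 b'A b'0 yz0 yb').
  apply: (orbit_rank_nonzero L0 Asym Auniq n5 (i := v) (j := ord0) aA ap) => //.
  by rewrite -ME y0 expr1n.
have [f [C [Ci dC]]] := minor_of_rank rk.
pose RC : idx := ([ffun j => enum_val (f j)], [ffun j => C j]).
have RCE : mon_mx y RC.1 RC.2 = mxsub f C (orbit_mx A y).
  by apply/matrixP => k l; rewrite !mxE /= !ffunE.
have RCi : injective RC.2 by move=> k l; rewrite !ffunE => /Ci.
have [d2|d2] := eqVneq (\det (mon_mx y R2 C2)) 0.
  rewrite (bigD1 RC) //= (g2P RC RCi L iota c y) ?mul0r ?mulr0 //.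
  by rewrite RCE.
rewrite (g1P L iota c y) ?mul0r //.
by rewrite mmapX mmap1U /slot_val pickC // insubF //= ltnn.
Qed.

Lemma generic_locus : A != [::] -> exists2 g, g != 0 & excludes g.
Proof.
move=> A0.
have [/hasP[a aA /existsP[p /existsP[p' ap]]]|nA] :=
    boolP (has (fun a : 'X_{1..n} => [exists p, exists p', (a p' < a p)%N]) A).
  exact: nonconstant_locus aA ap.
apply: constant_locus => // a p p' aA; apply/eqP; rewrite eqn_leq.
move/hasPn: nA => /(_ a aA)/existsPn nA.
have le u v : (a u <= a v)%N by move/existsPn: (nA u) => /(_ v); rewrite -leqNgt.
by rewrite !le.
Qed.
End GenericLocus.

(** * From points to ideals *)

Lemma map_mpoly_meval (K L : comNzRingType) (iota : {rmorphism K -> L}) n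
    (x : 'I_n -> L) (p : {mpoly K[n]}) : (map_mpoly iota p).@[x] = mmap iota x p.
Proof.
have -> : map_mpoly iota p = \sum_(m <- msupp p) iota p@_m *: 'X_[m].
  rewrite [p in LHS]mpolyE raddf_sum; apply: eq_bigr => m _ /=.
  by rewrite map_mpolyZ map_mpolyX.
by rewrite raddf_sum; apply: eq_bigr => m _ /=; rewrite mevalZ mevalX.
Qed.

Lemma mmap_msym_coeffs (K L : comNzRingType) (iota : {rmorphism K -> L}) n
    (x : 'I_n -> L) (A : seq 'X_{1..n}) (c : 'I_(size A) -> K) (s : 'S_n) :
  mmap iota x (msym s (poly_of_coeffs c)) =
  \sum_(l < size A) iota (c l) * mmap1 (fun i => x (s i)) (nth 0%MM A l).
Proof.
have -> : msym s (poly_of_coeffs c) =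
    \sum_(l < size A) c l *: 'X_[mperm (nth 0%MM A l) s^-1%g].
  by rewrite /poly_of_coeffs raddf_sum; apply: eq_bigr => l _ /=; rewrite msymZ msymX.
rewrite raddf_sum; apply: eq_bigr => l _ /=; rewrite mmapZ mmapX.
by rewrite (mmap1_mperm x _ s^-1%g) invgK.
Qed.

Lemma in_ideal_mmap0 (K L : comNzRingType) (iota : {rmorphism K -> L}) n
    (x : 'I_n -> L) (G : {mpoly K[n]} -> Prop) p :
  (forall g, G g -> mmap iota x g = 0) -> in_ideal G p -> mmap iota x p = 0.
Proof.
move=> Gx [r [g [c [Gg ->]]]]; rewrite raddf_sum big1 // => i _ /=.
by rewrite rmorphM /= (Gx _ (Gg i)) mulr0.
Qed.

(** A monomial with at least [k] positive exponents is divisible by the product of the first [k]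
    variables in its support. *)
Lemma in_sqfree_ideal (K : comNzRingType) n k (p : {mpoly K[n]}) :
  (forall m, m \in msupp p -> (k <= npos m)%N) -> in_ideal (@sqfree_monomials K n k) p.
Proof.
move=> pk; pose S (m : 'X_{1..n}) := [set i in take k (enum [pred i | (0 < m i)%N])].
pose m_ (i : 'I_(size (msupp p))) := nth 0%MM (msupp p) i.
have m_p i : m_ i \in msupp p by rewrite mem_nth.
exists (size (msupp p)), (fun i => 'X_[mesym1 (S (m_ i))]),
  (fun i => p@_(m_ i) *: 'X_[m_ i - mesym1 (S (m_ i))]); split=> [i|].
  exists (mesym1 (S (m_ i))); split; first by move=> j; rewrite mnmE; case: (_ \in _).
  split=> //; rewrite mdeg_mesym1 /S cardsE (card_uniqP _) ?take_uniq ?enum_uniq //.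
  by rewrite size_takel // -cardE pk.
rewrite [LHS]mpolyE (big_nth 0%MM) big_mkord; apply: eq_bigr => i _.
rewrite -scalerAl -mpolyXD submK //; apply/mnm_lepP => j; rewrite mnmE.
have [|//] := boolP (j \in S _); rewrite inE => /mem_take.
by rewrite mem_enum inE.
Qed.

(** If a monomial [m0] of [p] involved fewer than [k] variables, setting all other variables to 0
    would kill [G], hence a power of [p] and, in a domain, [p] itself, although [m0] survives. *)
Lemma in_sqfree_idealP (K : fieldType) n k (G : {mpoly K[n]} -> Prop) p :
  (forall g y, G g -> (#|[pred i : 'I_n | y i != 0%R :> {mpoly K[n]}]| < k)%N ->
     mmap (@mpolyC n K) y g = 0) ->
  in_radical G p -> in_ideal (@sqfree_monomials K n k) p.
Proof.
move=> Gy [e pe]; apply: in_sqfree_ideal => m0 m0p; rewrite leqNgt; apply/negP => m0k.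
pose y i : {mpoly K[n]} := if (0 < m0 i)%N then 'X_i else 0.
have yk : (#|[pred i | y i != 0%R]| < k)%N.
  apply: leq_ltn_trans m0k; apply/subset_leq_card/subsetP => i; rewrite !inE /y.
  by case: ifP; rewrite // eqxx.
have /eqP : mmap (@mpolyC n K) y (p ^+ e) = 0.
  by apply: in_ideal_mmap0 pe => g Gg; apply: Gy.
rewrite rmorphXn /= expf_eq0 => /andP[_ /eqP py].
have yE m : mmap1 y m = if [forall i, (0 < m i) ==> (0 < m0 i)]%N then 'X_[m] else 0.
  case: forallP => [mm|nm].
    rewrite mpolyXE_id; apply: eq_bigr => i _; rewrite /y.
    have [->|mi] := posnP (m i); first by rewrite !expr0.
    by have := mm i; rewrite mi /= => ->.
  have [i /=] : exists i, ~~ ((0 < m i) ==> (0 < m0 i))%N.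
    by apply/existsP; rewrite -negb_forall; apply/forallP.
  rewrite negb_imply => /andP[mi m0i]; rewrite /mmap1 (bigD1 i) //= /y (negPf m0i).
  by rewrite expr0n; case: (m i) mi => // j _; rewrite mul0r.
have := congr1 (mcoeff m0) py; rewrite mcoeff0 raddf_sum /=.
rewrite (bigD1_seq m0) ?msupp_uniq //= big1 => [|m mm]; last first.
  rewrite yE mcoeffCM; case: ifP; rewrite ?mcoeffX ?(negPf mm) ?mcoeff0 ?mulr0 //.
rewrite addr0 yE mcoeffCM; case: forallP => [_|[]]; last by move=> i; apply: implybb.
by rewrite mcoeffX eqxx mulr1 => /eqP; rewrite mcoeff_eq0 m0p.
Qed.

Theorem theorem1p1 (K : fieldType) (n : nat) (A : seq 'X_{1..n}) (k : nat) :
  [pchar K] =i pred0 ->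
  (5 <= n)%N ->
  A != [::] -> uniq A ->
  (exists d : nat, forall m, m \in A -> mdeg m = d) ->
  (forall m (s : 'S_n), m \in A -> mperm m s \in A) ->
  (exists2 m, m \in A & npos m = k) ->
  (forall m, m \in A -> (k <= npos m)%N) ->
  general_coeffs A (fun f : {mpoly K[n]} =>
    (forall p, in_radical (orbit_set f) p <-> in_ideal (@sqfree_monomials K n k) p)
    /\
    (forall (L : closedFieldType) (iota : {rmorphism K -> L}) (x : 'I_n -> L),
       (forall s : 'S_n, (map_mpoly iota (msym s f)).@[x] = 0) <->
       (n - k + 1 <= #|[pred i | x i == 0%R]|)%N)).
Proof.
case: n A => // n' A K0 n5 A0 Auniq [d Ahom] Asym [a aA ak] Ak.
have [g g0 gP] := generic_locus K0 n5 Auniq Ahom Asym A0.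
(* The open set is the complement of the single hypersurface [g = 0]; it has a point over [K]
   because [K] is infinite. *)
exists (eq^~ g); split.
  by have [c gc] := mpoly_nonroot K0 g0; exists c => /(_ g erefl)/eqP; rewrite (negPf gc).
move=> c nz; have gc : g.@[c] != 0.
  by apply/eqP => gc0; apply: nz => _ ->.
have vanish (S : comNzRingType) (iota : {rmorphism K -> S}) (x : 'I_n'.+1 -> S) s :
    (#|[pred i | x i != 0%R]| < k)%N -> mmap iota x (msym s (poly_of_coeffs c)) = 0.
  move=> xk; rewrite mmap_msym_coeffs big1 // => l _.
  rewrite -{1}[s]invgK -mmap1_mperm mmap1_eq0 ?mulr0 // (leq_trans xk) //.
  by rewrite Ak // Asym // mem_nth.
have few (L : fieldType) (iota : {rmorphism K -> L}) (x : 'I_n'.+1 -> L) :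
    (forall s, mmap iota x (msym s (poly_of_coeffs c)) = 0) ->
    (#|[pred i | x i != 0%R]| < k)%N.
  move=> xz; rewrite ltnNge; apply/negP => kx.
  have ax : (npos a <= #|[pred i | x i != 0%R]|)%N by rewrite ak.
  have [b bA xb] := support_fit Asym aA ax.
  case/eqP: gc; apply: (gP L iota c x); last by exists b.
  by move=> s; rewrite -mmap_msym_coeffs.
split=> [p|L iota x]; first split.
- apply: in_sqfree_idealP => _ y [s ->] yk; exact: vanish.
- move=> pk; apply: boolp.contrapT => /radical_point[L [iota [x [xz /eqP[]]]]].
  (* At a point where the orbit vanishes, fewer than [k] coordinates are nonzero, so every
     square-free monomial of degree [k] vanishes there, and with it [p]. *)
  have xk : (#|[pred i | x i != 0%R]| < k)%N.
    by apply: (few L iota) => s; apply: xz; exists s.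
  apply: in_ideal_mmap0 pk => _ [m [m1 [mk ->]]]; rewrite mmapX mmap1_eq0 //.
  apply: (leq_trans xk); rewrite -mk mdegE /npos -sum1_card [X in (_ <= X)%N]big_mkcond.
  apply: leq_sum => i _; rewrite inE; have := m1 i.
  by case: (m i) => [|[]].
have kn : (k <= n'.+1)%N by rewrite -ak (leq_trans (max_card _)) // card_ord.
have cnt : (#|[pred i | x i == 0%R]| + #|[pred i | x i != 0%R]| = n'.+1)%N.
  by rewrite -[RHS]card_ord -(cardC [pred i | x i == 0%R]); congr (_ + _)%N; apply: eq_card.
have -> : (n'.+1 - k + 1 <= #|[pred i | x i == 0%R]|)%N = (#|[pred i | x i != 0%R]| < k)%N.
  by move: cnt kn; move: #|_| #|_| => u v; lia.
split=> [xz|xk s]; last by rewrite map_mpoly_meval vanish.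
by apply: (few L iota) => s; rewrite -map_mpoly_meval.
Qed.
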